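(* Let $k\ge 3$ and $r\ge 1$ be integers. For every $j=1,\ldots,r$, the number $v^r_j$ of $k$-angulations with exactly $r$ $k$-gons (on points in convex position) whose root vertex has degree $j-1$ is $$v_{j}^{r} = \frac{j}{r}\binom{(k-1)r-j-1}{r-j}.$$
   Context: A geometric graph on a finite point set $\mathcal S\subseteq\mathbb R^2$ has vertex set $\mathcal S$ and edges that are straight-line segments with endpoints in $\mathcal S$; it is plane if no two edges intersect except at common endpoints. A $k$-angulation is a 2-connected plane geometric graph in which every internal face is a $k$-gon. A $k$-angulation with exactly $r$ $k$-gons has $(k-2)r+2$ vertices, taken to be points $p_1,\dots,p_{(k-2)r+2}$ in convex position labelled in counter-clockwise order. Its root vertex is $p_{(k-2)r+2}$, and the degree of the root vertex is defined as the number of its incident edges minus $2$. *)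

(* Defs.v *)
From HB Require Import structures.
From mathcomp Require Import all_boot all_order all_algebra.
From mathcomp Require Import all_classical all_reals all_analysis.

Set Implicit Arguments.
Unset Strict Implicit.
Unset Printing Implicit Defensive.

Import Order.TTheory GRing.Theory Num.Theory.
Import numFieldNormedType.Exports.

Local Open Scope classical_set_scope.
Local Open Scope ring_scope.

Definition orient (R : realType) (a b c : R * R) : R :=
  (b.1 - a.1) * (c.2 - a.2) - (c.1 - a.1) * (b.2 - a.2).

(* No point lies in the convex hull of the others; the hull is the smallest
   convex set containing them. *)
Definition convex_position (R : realType) (n : nat) (p : 'I_n -> R * R) : Prop :=
  forall i : 'I_n,
    ~ smallest (@convex_set R (R * R)%type) (p @` [set j | j != i]) (p i).

(* For points in convex position: increasing triples of indices turn left. *)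
Definition ccw_labelled (R : realType) (n : nat) (p : 'I_n -> R * R) : Prop :=
  forall i j l : 'I_n, (i < j)%N -> (j < l)%N -> 0 < orient (p i) (p j) (p l).

Definition segment (R : realType) (a b : R * R) : set (R * R) :=
  [set (1 - t) *: a + t *: b | t in `[0, 1]].

(* A graph is given by its set E of edges, each edge being the pair of indices
   of its two endpoints; the points p i are its vertices. *)
Definition simple_graph (n : nat) (E : {set {set 'I_n}}) : Prop :=
  forall e, e \in E -> #|e| = 2%N.

Definition adj (n : nat) (E : {set {set 'I_n}}) : rel 'I_n :=
  fun x y => [set x; y]%SET \in E.

Definition edge_segment (R : realType) (n : nat) (p : 'I_n -> R * R)
    (e : {set 'I_n}) : set (R * R) :=
  [set z | exists x y, e = [set x; y]%SET /\ segment (p x) (p y) z].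

Definition plane (R : realType) (n : nat) (p : 'I_n -> R * R)
    (E : {set {set 'I_n}}) : Prop :=
  forall e f, e \in E -> f \in E -> e != f ->
    edge_segment p e `&` edge_segment p f `<=` p @` [set` (e :&: f)%SET].

(* k-connectedness for k = 2: more than two vertices, and deleting any set X
   of fewer than two vertices leaves a connected graph. *)
Definition two_connected (n : nat) (E : {set {set 'I_n}}) : Prop :=
  (2 < n)%N /\
  forall X : {set 'I_n}, (#|X| < 2)%N ->
  forall x y, x \notin X -> y \notin X ->
    connect [rel u v | [&& adj E u v, u \notin X & v \notin X]] x y.

Definition drawing (R : realType) (n : nat) (p : 'I_n -> R * R)
    (E : {set {set 'I_n}}) : set (R * R) :=
  range p `|` \bigcup_(e in [set` E]) edge_segment p e.

(* The internal faces are the bounded connected components of the complement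
   of the drawing. *)
Definition internal_faces (R : realType) (n : nat) (p : 'I_n -> R * R)
    (E : {set {set 'I_n}}) : set (set (R * R)) :=
  [set F | bounded_set F /\
     exists2 z, (~` drawing p E) z & F = connected_component (~` drawing p E) z].

(* The topological boundary of F is a cycle of the graph with k vertices,
   hence, for k > 2, with k edges. *)
Definition is_kgon (R : realType) (k n : nat) (p : 'I_n -> R * R)
    (E : {set {set 'I_n}}) (F : set (R * R)) : Prop :=
  exists s : seq 'I_n, [/\ size s = k, ucycle (adj E) s &
    closure F `\` interior F =
      \bigcup_(x in [set` s]) segment (p x) (p (next s x))].

Definition kangulation (R : realType) (k n : nat) (p : 'I_n -> R * R)
    (E : {set {set 'I_n}}) : Prop :=
  [/\ simple_graph E, plane p E, two_connected E &
      internal_faces p E `<=` is_kgon k p E].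

(* The last point is the root. The subtraction is not truncated on
   2-connected graphs, where every vertex has at least two incident edges. *)
Definition root_degree (n : nat) (E : {set {set 'I_n.+1}}) : nat :=
  (#|[set e in E | ord_max \in e]%SET| - 2)%N.

(* v_j^r, for the (k - 2) r + 2 points p; graphs are counted as labelled by the
   points, i.e. not up to symmetry. *)
Definition kangulation_count (R : realType) (k r j : nat)
    (p : 'I_((k - 2) * r).+2 -> R * R) : nat :=
  #|[pred E : {set {set 'I_((k - 2) * r).+2}} |
      `[< [/\ kangulation k p E, (internal_faces p E #= `I_r)%card &
              root_degree E = (j - 1)%N] >]]|.
Arguments kangulation_count {R} k r j p.

(* Main.v *)
Require Import Defs.
From mathcomp Require Import all_boot all_order all_algebra.
From mathcomp Require Import all_classical all_reals all_analysis.
From mathcomp Require Import zify ring lra.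
Set Implicit Arguments.
Unset Strict Implicit.
Unset Printing Implicit Defensive.
Import Order.TTheory GRing.Theory Num.Theory.
Import numFieldNormedType.Exports.
Local Open Scope ring_scope.

(* A k-angulation is determined by its set D of pairs x < y of adjacent,
   non-consecutive vertices, which contains the outer side {0, n - 1}. Each
   internal face is an open convex polygon and lies directly below exactly one
   e in D: its vertices are those of the arc [e.1, e.2] that no other member of
   D inside this arc cuts off. So faces correspond to members of D, and a plane
   2-connected graph is a k-angulation iff all these vertex sets have k elements.

   For the count, consider partial dissections of the points 0, ..., b whose
   upper boundary from 0 to b has h sides. Either no diagonal ends at b, and b
   is erased, or the outermost diagonal ending at b is erased, which replaces h
   by h + k - 2. This is the recurrence of a ballot number. Erasing in this way
   the j diagonals at the root (the outer side among them) leaves a partial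
   dissection of the other vertices with h = (k - 2) j. *)

(** * Counting dissections *)

(** Putting the outer side into [D] settles the boundary cases: every internal face, the one at the
    outer side included, has a member of [D] above it, and degree j - 1 at the root means j members
    of [D] there. The boundary length h is kept free because splitting complete dissections would
    give convolutions, whereas the recurrence with h has two terms and is solved by Pascal's rule.
    The geometric difficulty is that internal faces are bounded components of a complement. Polygons
    are therefore written as intersections of half-planes bounded by their sides. Such a set is
    connected and open, and its closure adds only points of the drawing, so it is a whole component.
    Conversely, a point inside the hull and off the drawing lies in the face of the narrowest chord
    above it, and a point outside escapes to infinity along a ray. For plane graphs on these points,
    2-connectedness amounts to containing all sides of the hull. *)

Section Diagonals.
Local Open Scope nat_scope.
Variable n : nat.
Implicit Types (D : {set 'I_n * 'I_n}) (e f : 'I_n * 'I_n) (S : {set 'I_n}).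

Definition covered D (a b v : nat) :=
  [exists e in D, [&& a <= e.1, e.2 <= b, e.1 < v & v < e.2]].

(* The vertices of [a, b] that can be seen from above the chord {a, b}. *)
Definition vis D (a b : nat) : {set 'I_n} :=
  [set v : 'I_n | [&& a <= v, v <= b & ~~ covered D a b v]].

Definition noncrossing D :=
  [forall e in D, forall f in D, ~~ [&& e.1 < f.1, f.1 < e.2 & e.2 < f.2]].

Definition diagonals D (b : nat) :=
  [forall e in D, (e.1.+1 < e.2) && (e.2 <= b)].

(** [e] is left out because it would itself hide every vertex strictly inside its arc. *)
Definition face D e := vis (D :\ e) e.1 e.2.

(** For [x] in [S], the position of [x] in increasing order, counted from 1. *)
Definition rank S (x : nat) := #|[set v in S | v <= x]|.

Lemma coveredP D a b v :
  reflect (exists2 e, e \in D & [/\ a <= e.1, e.2 <= b, e.1 < v & v < e.2])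
    (covered D a b v).
Proof.
apply: (iffP existsP) => [[e /andP[eD /and4P[*]]]|[e eD [*]]]; exists e => //.
by rewrite eD /=; apply/and4P; split.
Qed.

Lemma noncrossingP D :
  reflect (forall e f, e \in D -> f \in D ->
             e.1 < f.1 -> f.1 < e.2 -> e.2 < f.2 -> False) (noncrossing D).
Proof.
apply: (iffP forall_inP) => [H e f eD fD h1 h2 h3|H e eD].
  by move: (forall_inP (H e eD) f fD); rewrite h1 h2 h3.
by apply/forall_inP => f fD; apply/negP => /and3P[]; apply: H.
Qed.

Lemma diagonalsP D b :
  reflect (forall e, e \in D -> e.1.+1 < e.2 /\ e.2 <= b) (diagonals D b).
Proof.
by apply: (iffP forall_inP) => H e /H; [move/andP|move=> ?; apply/andP].
Qed.

Lemma noncrossingS D D' : D \subset D' -> noncrossing D' -> noncrossing D.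
Proof.
move=> /fintype.subsetP sD /noncrossingP H; apply/noncrossingP => e f eD fD.
by apply: H; apply: sD.
Qed.

Lemma diagonalsS D D' b : D \subset D' -> diagonals D' b -> diagonals D b.
Proof. by move=> /fintype.subsetP sD /diagonalsP H; apply/diagonalsP => e /sD/H. Qed.

Lemma covered_setU1 D e a b v : covered (e |: D) a b v =
  [&& a <= e.1, e.2 <= b, e.1 < v & v < e.2] || covered D a b v.
Proof.
apply/coveredP/orP => [[f /setU1P[->|fD] [*]]|[/and4P[*]|/coveredP[f fD [*]]]].
- by left; apply/and4P; split.
- by right; apply/coveredP; exists f.
- by exists e; rewrite ?setU11.
- by exists f; rewrite ?inE ?fD ?orbT.
Qed.

(** If [v] is not [u + 1], then [u + 1] is hidden by a member of [D], which must start at [u] since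
    [u] is visible. Take the one from [u] with the furthest end [y]; it cannot pass [v]. If [y] came
    before [v], it would be hidden by a member that hides [u], crosses [(u, y)] or contradicts the
    choice of [y]. *)
Lemma vis_adjacent D (a b : nat) (u v : 'I_n) : noncrossing D ->
  u \in vis D a b -> v \in vis D a b -> u < v ->
  (forall w, w \in vis D a b -> u < w -> w < v -> False) ->
  v = u.+1 :> nat \/ (u, v) \in D.
Proof.
move=> /noncrossingP nc; rewrite !inE => /and3P[au ub uc] /and3P[av vb vc] uv hw.
case: (ltnP u.+1 v) => [u1v|]; last by left; lia.
right.
have u1n : u.+1 < n by apply: ltn_trans (ltn_ord v).
pose P (y : 'I_n) := ((u, y) \in D) && (y <= b).
have [y0 Py0] : exists y, P y && (u.+1 < y).
  have : ~~ (Ordinal u1n \in vis D a b) by apply/negP => /hw /=; lia.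
  rewrite inE /= negb_and (leqW au) /= negb_and negbK.
  case/orP => [|/coveredP[[x y] xyD] /= [ax yb xu uy]]; first by lia.
  have xu' : x = u.
    apply/val_inj/eqP; rewrite eqn_leq -ltnS xu /= leqNgt; apply/negP => xu'.
    by move/negP: uc; apply; apply/coveredP; exists (x, y) => //; split => //=; lia.
  by exists y; rewrite /P -xu' xyD yb /= xu'.
have [Py0' uy0] := andP Py0.
case: (arg_maxnP (fun y : 'I_n => y : nat) Py0') => y /andP[uyD yb] ymax.
have yv : y <= v.
  rewrite leqNgt; apply/negP => vy; move/negP: vc; apply; apply/coveredP.
  by exists (u, y).
case: (ltngtP y v) yv => // [yv _|/val_inj <- //].
have uy : u < y by apply: leq_trans (ymax _ Py0'); lia.
have : ~~ (y \in vis D a b) by apply/negP => /hw; lia.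
rewrite inE (leq_trans au (ltnW uy)) yb /= negbK => /coveredP[[x' y'] xyD] /= [ax yb' xy yy].
case: (ltngtP x' u) => [xu|ux|/val_inj xu].
- by move/negP: uc; case; apply/coveredP; exists (x', y') => //; split => //=; lia.
- by case: (nc _ _ uyD xyD).
- by subst x'; have := ymax y'; rewrite /P xyD yb' => /(_ isT); lia.
Qed.

Lemma rank_inj S (x y : 'I_n) : x \in S -> y \in S -> rank S x = rank S y -> x = y.
Proof.
suff lt (u v : 'I_n) : v \in S -> u < v -> rank S u < rank S v.
  move=> xS yS H; case: (ltngtP x y) => [/(lt _ _ yS)|/(lt _ _ xS)|/val_inj //];
  by rewrite H ltnn.
move=> vS uv; apply: proper_card; apply/properP; split.
  by apply/fintype.subsetP => w; rewrite !inE => /andP[-> /= ]; lia.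
by exists v; rewrite !inE vS //= -ltnNge.
Qed.

Lemma rank_ex S h : 0 < h <= #|S| -> exists2 x, x \in S & rank S x = h.
Proof.
move=> /andP[h0]; move mE : #|S| => m; elim: m S mE => [|m IH] S mE hm; first lia.
have [x0 x0S] : exists x, x \in S by apply/set0Pn; rewrite -card_gt0 mE.
case: (arg_maxnP (fun y : 'I_n => y : nat) x0S) => x xS xmax.
case: (ltngtP h m.+1) hm => // [hm _|-> _]; last first.
  exists x => //; rewrite -mE; apply: eq_card => w; rewrite inE.
  by case wS: (w \in S) => //=; apply: xmax.
have {}xS : x \in S := xS.
have [|//|y] := IH (S :\ x); first by move: (cardsD1 x S); rewrite xS mE add1n => -[].
rewrite !inE => /andP[yx yS] <-; exists y => //; apply: eq_card => w; rewrite !inE.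
case: eqVneq => [->|] //=; rewrite xS /=.
by apply/negbTE; rewrite -ltnNge ltn_neqAle [_ <= _](xmax y yS) andbT.
Qed.

(* Here [k] stands for the [k - 2] of the theorem; the visible chain from 0 to
   [b], with its [h.+1] vertices, is the upper boundary of the partial dissection. *)
Definition dissections (k b h : nat) : {set {set 'I_n * 'I_n}} :=
  [set D | [&& diagonals D b, noncrossing D, [forall e in D, #|face D e| == k.+2]
             & #|vis D 0 b| == h.+1]].

Definition indegree D (b : nat) := #|[set e in D | e.2 == b :> nat]|.

Lemma dissectionsP k b h D :
  reflect [/\ diagonals D b, noncrossing D,
              forall e, e \in D -> #|face D e| = k.+2 & #|vis D 0 b| = h.+1]
    (D \in dissections k b h).
Proof.
rewrite inE; apply: (iffP and4P) => [[? ? /forall_inP H /eqP ?]|[? ? H ?]]; split => //.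
- by move=> e /H/eqP.
- by apply/forall_inP => e /H/eqP.
- by apply/eqP.
Qed.

(** Only a member of [D] whose arc contains [(x, b)] could be affected. It would end at [b] and
    start no later than [x], which the last hypothesis excludes. *)
Lemma face_setU1 D (x b : 'I_n) e : (x, b) \notin D -> e \in D ->
  diagonals D b -> (forall y, (y, b) \in D -> x < y) ->
  face ((x, b) |: D) e = face D e.
Proof.
move=> xbD eD dD xmin; rewrite /face.
have -> : ((x, b) |: D) :\ e = (x, b) |: (D :\ e).
  rewrite finset.setDUl; congr (_ :|: _); apply/setP => f; rewrite !inE.
  by case: eqVneq => [->|]; rewrite ?andbF //; case: eqVneq => // E; rewrite -E eD in xbD.
apply/setP => v; rewrite !inE covered_setU1 /=.
have [_ e2b] := diagonalsP _ _ dD _ eD.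
case: (leqP e.1 x) => //= e1x; case: (leqP b e.2) => //= be2.
have E : e.2 = b by apply: val_inj; apply/eqP; rewrite eqn_leq e2b.
by have := xmin e.1; rewrite -E -surjective_pairing => /(_ eD); lia.
Qed.

(** No member of [D] passes over the visible vertex [x], so whatever is hidden to the right of [x]
    is hidden by a member that starts at [x] or later. *)
Lemma vis_split D (x : 'I_n) (b : nat) : x \in vis D 0 b ->
  vis D 0 b = [set v in vis D 0 b | v < x] :|: vis D x b /\
  [disjoint [set v in vis D 0 b | v < x] & vis D x b].
Proof.
rewrite inE /= => /andP[xb /negP xc]; split; last first.
  by rewrite finset.disjoints_subset; apply/fintype.subsetP => v; rewrite !inE => /andP[_]; lia.
apply/setP => v; rewrite !inE /=.
case: (ltnP v x) => vx; rewrite ?andbT ?andbF ?orbF //=.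
case: (leqP v b) => //= vb; congr (~~ _).
apply/idP/idP => /coveredP[e eD [e1 e2 e3 e4]]; apply/coveredP; exists e => //; split => //.
case: (leqP x e.1) => // ex; case: xc; apply/coveredP; exists e => //; split => //; lia.
Qed.

Lemma vis_split_card D (x : 'I_n) (b : nat) : x \in vis D 0 b ->
  (#|vis D 0 b|).+1 = rank (vis D 0 b) x + #|vis D x b|.
Proof.
move=> xv; have [E dj] := vis_split xv.
rewrite {1}E cardsU finset.disjoint_setI0 // cards0 subn0 -addSn; congr (_ + _).
rewrite /rank.
have -> : [set v in vis D 0 b | v <= x] = x |: [set v in vis D 0 b | v < x].
  apply/setP => v; rewrite [RHS]inE finset.in_set1 [LHS]inE [in RHS]inE leq_eqVlt.
  have -> : (v == x :> nat) = (v == x) by [].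
  by case: eqVneq => [->|] //=; rewrite xv.
by rewrite cardsU1 inE ltnn andbF.
Qed.

Lemma vis_setU1 D (x b : 'I_n) : diagonals D b -> x < b -> x \in vis D 0 b ->
  vis ((x, b) |: D) 0 b = b |: [set v in vis D 0 b | v <= x].
Proof.
move=> /diagonalsP dD xb; rewrite !inE /= => /andP[_ xc].
apply/setP => v; rewrite !inE covered_setU1 /= leqnn /=.
have -> : (v == b) = (v == b :> nat) by [].
case: eqP => [->|/eqP vb] /=.
  rewrite leqnn ltnn andbF /=; apply/negP => /coveredP[e /dD[_ ?] [*]]; lia.
case: (ltnP x v) => xv /=; last by rewrite andbT.
rewrite andbF; case: (ltngtP v b) vb => // *; by rewrite ?andbF.
Qed.

(** The chain has [h + k + 1] vertices and [x] is the [h]-th, so [k + 2] of them run from [x] to [b]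
    and become the new face; the [h] vertices up to [x] and [b] itself stay visible. The first two
    conclusions say that the new diagonal is the outermost one at [b], which makes it
    recoverable. *)
Lemma dissections_add k b h D (x : 'I_n) : 0 < k -> D \in dissections k b (h + k) ->
  x \in vis D 0 b -> rank (vis D 0 b) x = h ->
  forall (bn : 'I_n), bn = b :> nat ->
  [/\ (forall y, (y, bn) \in D -> x < y), (x, bn) \notin D &
      (x, bn) |: D \in dissections k b h].
Proof.
move=> k0 /dissectionsP[dD nD fD vD] xv rx bn bE; subst b.
have cx := vis_split_card xv; rewrite vD rx in cx.
have {}cx : #|vis D x bn| = k.+2 by lia.
have xvx : x \in vis D x bn.
  move: xv; rewrite !inE leqnn /= => /andP[-> /negP xc]; apply/negP => H; apply: xc.
  by move: H => /coveredP[e eD [? ? ? ?]]; apply/coveredP; exists e => //; split.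
(* As [k > 0], some visible [y] lies strictly between [x] and [b]. A member of [D] ending at [b] and
   starting at or before [x] would hide [x] or [y]. *)
have [y yv /andP[yx yb]] : exists2 y, y \in vis D x bn & (y != x) && (y != bn).
  have : 0 < #|vis D x bn :\ x :\ bn|.
    have := cardsD1 x (vis D x bn); rewrite xvx cx add1n => -[].
    rewrite (cardsD1 bn (vis D x bn :\ x)).
    by case: (_ \in _); rewrite /= ?add1n ?add0n; [move=> [<-] | move=> <-].
  by case/card_gt0P => y; rewrite !in_setD1 => /and3P[y1 y2 y3]; exists y; rewrite ?y1 ?y2.
have [xy {}yb] : x < y /\ y < bn.
  move: yv; rewrite inE => /and3P[xy' yb' _].
  by split; rewrite ltn_neqAle ?xy' ?yb' andbT // eq_sym.
have yc : ~~ covered D x bn y by move: yv; rewrite inE => /and3P[].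
have xc : ~~ covered D 0 bn x by move: xv; rewrite inE => /and3P[].
have xmin z : (z, bn) \in D -> x < z.
  move=> zD; rewrite ltnNge; apply/negP => zx.
  case: (ltngtP z x) zx => // [zx _|/val_inj zx _].
    move/negP: xc; apply; apply/coveredP; exists (z, bn) => //.
    by split => //=; apply: ltn_trans xy yb.
  by subst z; move/negP: yc; apply; apply/coveredP; exists (x, bn).
have xD : (x, bn) \notin D by apply/negP => /xmin; rewrite ltnn.
split=> //; apply/dissectionsP; split.
- apply/diagonalsP => e /setU1P[->|/(diagonalsP _ _ dD)//] /=.
  by split => //; apply: leq_ltn_trans yb.
- apply/noncrossingP => e f /setU1P[->|eD] /setU1P[->|fD'] //=; first by rewrite ltnn.
  + by have [_ /leq_ltn_trans h1] := diagonalsP _ _ dD _ fD' => _ _ /h1; rewrite ltnn.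
  + move=> e1 e2 e3; move/negP: xc; apply; apply/coveredP; exists e => //.
    by split => //; have [] := diagonalsP _ _ dD _ eD.
  + exact: (noncrossingP _ nD).
- move=> e /setU1P[->|eD]; last by rewrite face_setU1 // fD.
  rewrite /face /= finset.setU1K //.
- have xb := ltn_trans xy yb; rewrite vis_setU1 //.
  by rewrite cardsU1 -/(rank _ _) rx inE negb_and orbC -ltnNge xb.
Qed.

(** Among the diagonals ending at [b], the one with the least start is erased: no other member hides
    its start, so the [k] inner vertices of its face join the visible chain. *)
Lemma dissections_remove k b h D : D \in dissections k b h -> 0 < indegree D b ->
  exists x bn : 'I_n, [/\ bn = b :> nat, (x, bn) \in D,
    D :\ (x, bn) \in dissections k b (h + k),
    x \in vis (D :\ (x, bn)) 0 b & rank (vis (D :\ (x, bn)) 0 b) x = h].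
Proof.
move=> /dissectionsP[dD nD fD vD] /card_gt0P[[x0 bn]]; rewrite inE /= => /andP[x0D /eqP bE].
subst b; exists [arg min_(x < x0 | (x, bn) \in D) x], bn.
case: arg_minnP => // x xD xmin.
have [xb _] := diagonalsP _ _ dD _ xD; rewrite /= in xb.
set D' := D :\ (x, bn).
have DE : D = (x, bn) |: D' by rewrite finset.setD1K.
have xD' : (x, bn) \notin D' by rewrite !inE eqxx.
have sD : D' \subset D by apply: subsetDl.
have dD' : diagonals D' bn := diagonalsS sD dD.
have xmin' y : (y, bn) \in D' -> x < y.
  rewrite !inE => /andP[yx /xmin]; rewrite leq_eqVlt => /orP[/eqP/val_inj E|//].
  by rewrite E eqxx in yx.
have xv : x \in vis D' 0 bn.
  rewrite inE /=; apply/andP; split; first lia.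
  apply/coveredP => -[e eD [_ e2 e3 e4]].
  case: (ltngtP e.2 bn) e2 => // [e2 _|/val_inj e2 _].
    by apply: (noncrossingP _ nD e (x, bn)) => //; apply: (fintype.subsetP sD).
  by have := xmin' e.1; rewrite -e2 -surjective_pairing => /(_ eD); lia.
have cv := vis_split_card xv.
have fx : #|vis D' x bn| = k.+2 by have := fD _ xD.
have rx : rank (vis D' 0 bn) x = h.
  have xb' : x < bn := ltnW xb.
  move: vD; rewrite DE vis_setU1 // cardsU1 -/(rank _ _) inE negb_and orbC -ltnNge xb' /=; lia.
split => //; apply/dissectionsP; split => //.
- exact: noncrossingS nD.
- by move=> e eD; rewrite -(fD e (fintype.subsetP sD _ eD)) [in RHS]DE face_setU1.
- by move: cv; rewrite rx fx addnS addnS => -[->].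
Qed.

Lemma indegree_setU1 D (x b : 'I_n) : (x, b) \notin D ->
  indegree ((x, b) |: D) b = (indegree D b).+1.
Proof.
move=> xD; rewrite /indegree.
have -> : [set e in (x, b) |: D | e.2 == b :> nat] = (x, b) |: [set e in D | e.2 == b :> nat].
  by apply/setP => e; rewrite !inE; case: (eqVneq e (x, b)) => //= ->; rewrite eqxx.
by rewrite cardsU1 inE negb_and xD.
Qed.

(* Adding the diagonal that closes the last [k.+1] visible sides is a bijection
   onto the dissections with a diagonal ending at [b]. *)
Lemma card_dissections_indegree k (b : 'I_n) h (P : pred nat) : 0 < k -> 0 < h ->
  #|[set D in dissections k b h | (0 < indegree D b) && P (indegree D b)]| =
  #|[set D in dissections k b (h + k) | P (indegree D b).+1]|.
Proof.
move=> k0 h0.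
(* The default [b] is never taken: since [0 < h], a chain of [h + k + 1] vertices has one of rank
   [h]. *)
pose g D := (odflt b [pick x in vis D 0 b | rank (vis D 0 b) x == h], b) |: D.
have gP D : D \in dissections k b (h + k) -> exists x, [/\ g D = (x, b) |: D,
    x \in vis D 0 b & rank (vis D 0 b) x = h].
  move=> DW; rewrite /g; case: pickP => [x /andP[xv /eqP rx]|]; first by exists x.
  case/dissectionsP: DW => _ _ _ vD.
  have [|x xv /eqP rx] := @rank_ex (vis D 0 b) h; first by rewrite vD; lia.
  by move/(_ x); rewrite xv rx.
suff -> : [set D in dissections k b h | (0 < indegree D b) && P (indegree D b)] =
    g @: [set D in dissections k b (h + k) | P (indegree D b).+1].
  apply: card_in_imset => D1 D2 /setIdP[W1 _] /setIdP[W2 _].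
  have [x1 [-> v1 r1]] := gP _ W1; have [x2 [-> v2 r2]] := gP _ W2.
  have [m1 n1 _] := dissections_add k0 W1 v1 r1 (erefl (b : nat)).
  have [m2 n2 _] := dissections_add k0 W2 v2 r2 (erefl (b : nat)).
  move=> E.
  (* If they differed, each added diagonal would belong to the other set, and [x1] and [x2] would
     each be smaller than the other. *)
  have x12 : x1 = x2.
    have : (x1, b) \in (x2, b) |: D2 by rewrite -E setU11.
    have : (x2, b) \in (x1, b) |: D1 by rewrite E setU11.
    case/setU1P => [[//]|/m1 h1] /setU1P[[//]|/m2 h2]; lia.
  by rewrite -(finset.setU1K n1) E -x12 finset.setU1K // x12.
apply/setP => D; apply/idP/imsetP.
- rewrite inE => /and3P[DW i0 Pi].
  have [x [bn [/val_inj bE xD DW' xv rx]]] := dissections_remove DW i0; subst bn.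
  have xD' : (x, b) \notin D :\ (x, b) by rewrite !inE eqxx.
  exists (D :\ (x, b)).
    by rewrite inE DW' -(indegree_setU1 xD') finset.setD1K.
  have [y [-> yv ry]] := gP _ DW'.
  by rewrite (rank_inj yv xv (etrans ry (esym rx))) finset.setD1K.
- case=> D' /setIdP[DW' Pi] ->.
  have [x [-> xv rx]] := gP _ DW'.
  have [m1 n1 DW] := dissections_add k0 DW' xv rx (erefl (b : nat)).
  by rewrite inE DW indegree_setU1.
Qed.

Lemma dissections_succ k b h D : b.+1 < n ->
  (D \in dissections k b.+1 h.+1) && (indegree D b.+1 == 0) = (D \in dissections k b h).
Proof.
move=> bn.
have visS : diagonals D b -> #|vis D 0 b.+1| = (#|vis D 0 b|).+1.
  move=> /diagonalsP dD.
  have -> : vis D 0 b.+1 = Ordinal bn |: vis D 0 b.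
    apply/setP => v; rewrite !inE /=.
    have -> : (v == Ordinal bn) = (v == b.+1 :> nat) by [].
    have -> : covered D 0 b.+1 v = covered D 0 b v.
      apply/coveredP/coveredP => -[e eD [? ? ? ?]]; exists e => //; split => //; last lia.
      by case: (dD e eD).
    case: eqP => [->|/eqP vb] /=; last by rewrite leq_eqVlt (negbTE vb).
    rewrite leqnn /=; apply/coveredP => -[e /dD[_ ?] [*]]; lia.
  by rewrite cardsU1 inE /= ltnn.
apply/andP/idP => [[/dissectionsP[dD nD fD vD] /eqP/cards0_eq i0]|
    /dissectionsP[dD nD fD vD]].
  have dD' : diagonals D b.
    apply/diagonalsP => e eD; have [-> e2] := diagonalsP _ _ dD e eD; split => //.
    move/setP/(_ e): i0; rewrite !inE eD /=; lia.
  by apply/dissectionsP; split => //; have := visS dD'; rewrite vD => -[].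
split.
  apply/dissectionsP; split => //; last by rewrite visS // vD.
  by apply/diagonalsP => e /(diagonalsP _ _ dD)[]; lia.
apply/eqP/eqP; rewrite cards_eq0; apply/eqP/setP => e; rewrite !inE.
case eD: (e \in D) => //=; have [] := diagonalsP _ _ dD e eD; lia.
Qed.

Lemma card_dissections_succ k b h : 0 < k -> b.+1 < n ->
  #|dissections k b.+1 h.+1| = #|dissections k b h| + #|dissections k b.+1 (h.+1 + k)|.
Proof.
move=> k0 bn.
have H := @card_dissections_indegree k (Ordinal bn) h.+1 xpredT k0 isT.
rewrite -(cardsID [set D | indegree D b.+1 == 0]); congr (_ + _).
  by apply: eq_card => D; rewrite finset.in_setI [X in _ && X]inE dissections_succ.
rewrite -[RHS]/(#|pred_of_set _|).
transitivity #|[set D in dissections k (Ordinal bn) (h.+1 + k) |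
                 xpredT (indegree D (Ordinal bn)).+1]|.
  rewrite -H; apply: eq_card => D; rewrite finset.in_setD [X in ~~ X]inE [RHS]inE andbT andbC.
  by rewrite lt0n.
by apply: eq_card => D; rewrite inE andbT.
Qed.

Lemma card_dissections_last k b j h : 0 < k -> b.+1 < n ->
  #|[set D in dissections k b.+1 h.+1 | indegree D b.+1 == j]| =
  #|dissections k b (h + j * k)|.
Proof.
move=> k0 bn; elim: j h => [|j IH] h.
  rewrite addn0; apply: eq_card => D; rewrite [LHS]inE; exact: dissections_succ.
have /= := @card_dissections_indegree k (Ordinal bn) h.+1 (pred1 j.+1) k0 isT.
have -> : [set D in dissections k b.+1 h.+1 | (0 < indegree D b.+1) && (indegree D b.+1 == j.+1)]
   = [set D in dissections k b.+1 h.+1 | indegree D b.+1 == j.+1].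
  by apply/setP => D; rewrite inE [RHS]inE; case: eqP => [->|]; rewrite ?andbF ?andbT.
move=> ->.
have -> : [set D in dissections k b.+1 (h.+1 + k) | (indegree D b.+1).+1 == j.+1] =
   [set D in dissections k b.+1 (h + k).+1 | indegree D b.+1 == j].
  by apply/setP => D; rewrite [LHS]finset.in_set [RHS]finset.in_set eqSS addSn.
by rewrite IH mulSn addnA.
Qed.

End Diagonals.

(** * The ballot recurrence and its solution *)

Section Counting.
Local Open Scope nat_scope.
Variable n : nat.

Lemma dissections_small k b h : b < h -> dissections n k b h = finset.set0.
Proof.
move=> bh; apply/setP => D; rewrite finset.in_set0; apply/negP => /dissectionsP[_ _ _ vD].
suff : #|vis D 0 b| <= b.+1 by rewrite vD ltnS leqNgt bh.
rewrite -[X in _ <= X]card_ord.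
case: (ltnP b n) => bn; last first.
  by rewrite card_ord (leq_trans (max_card _)) // card_ord (leq_trans bn).
have wi : injective (widen_ord bn) by move=> x y [/val_inj].
rewrite -(card_imset _ wi).
apply/subset_leq_card/fintype.subsetP => v; rewrite inE /= => /andP[vb _].
by apply/imsetP; exists (Ordinal (vb : v < b.+1)) => //; apply: val_inj.
Qed.

Lemma dissections00 k : 0 < n -> #|dissections n k 0 0| = 1.
Proof.
move=> n0; rewrite -[RHS](cards1 (finset.set0 : {set 'I_n * 'I_n})).
apply: eq_card => D; rewrite finset.in_set1; apply/dissectionsP/eqP => [[dD _ _ _]|->].
  apply/eqP; rewrite -[_ == _]negbK; apply/set0Pn => -[e /(diagonalsP _ _ dD)[]]; lia.
split; try by [apply/diagonalsP => e; rewrite inE|move=> e; rewrite inE].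
- by apply/noncrossingP => e f; rewrite inE.
- rewrite -[RHS](cards1 (Ordinal n0)); apply: eq_card => v; rewrite !inE /=.
  have -> : covered (finset.set0 : {set 'I_n * 'I_n}) 0 0 v = false.
    by apply/coveredP => -[e]; rewrite inE.
  by rewrite andbT leqn0.
Qed.

Lemma dissections_pos0 k b : 0 < b < n -> dissections n k b 0 = finset.set0.
Proof.
case: b => // b bn; apply/setP => D; rewrite finset.in_set0; apply/negP => /dissectionsP[dD _ _].
have n0 : 0 < n by apply: leq_trans bn.
have : [set Ordinal n0; Ordinal bn] \subset vis D 0 b.+1.
  apply/fintype.subsetP => v /set2P[]->; rewrite inE /= ?leqnn;
    apply/negP => /coveredP[e eD [*]] //.
  by have [] := diagonalsP _ _ dD e eD; lia.
by move=> /subset_leq_card; rewrite cards2 => /leq_trans H vD; have := H 1; rewrite vD => /(_ isT).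
Qed.

Lemma card_dissections0 k h : 0 < k -> h < n -> #|dissections n k h h| = 1.
Proof.
move=> k0; elim: h => [|h IH] hn; first exact: dissections00.
rewrite card_dissections_succ // (@dissections_small k h.+1); last lia.
by rewrite cards0 addn0 IH // ltnW.
Qed.

(* This is the ballot number of the paths with [u.+1] steps [+k] and steps [-1] that start
   at height [h] and end at their first visit to 0. *)
Lemma card_dissections k u h : 0 < k -> h + u.+1 * k < n ->
  #|dissections n k (h + u.+1 * k) h| + k * 'C((h + k.+1 * u.+1).-1, u) =
  'C((h + k.+1 * u.+1).-1, u.+1).
Proof.
(* One term of the recurrence lowers [h] and keeps [u], the other raises [h] and lowers [u]; hence
   [u] is the outer induction and [h] the inner one. *)
move=> k0; elim: u h => [|u IHu]; elim=> [|h IHh] hn.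
- rewrite dissections_pos0; last by lia.
  by rewrite cards0 !add0n muln1 bin0 bin1 muln1.
- rewrite addSn card_dissections_succ //.
  have -> : (h + 1 * k).+1 = h.+1 + k by rewrite mul1n.
  rewrite card_dissections0 //; last by lia.
  have := IHh ltac:(lia); rewrite !bin0 !bin1 !muln1; lia.
- rewrite dissections_pos0; last by lia.
  (* With no dissections left, the two binomial terms must agree. They do because
     [m - (u + 1) = k * (u + 2)] for [m = (k + 1) * (u + 2) - 1]. *)
  rewrite cards0 add0n; apply/eqP; rewrite -(eqn_pmul2l (isT : 0 < u.+2)) mul_bin_left.
  by apply/eqP; rewrite mulnA; congr (_ * _); lia.
- rewrite addSn card_dissections_succ //.
  have -> : (h + u.+2 * k).+1 = (h.+1 + k) + u.+1 * k by lia.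
  have := IHh ltac:(lia); have := IHu (h.+1 + k) ltac:(lia).
  have -> : (h.+1 + k + k.+1 * u.+1).-1 = (h + k.+1 * u.+2).-1 by lia.
  have -> : (h.+1 + k.+1 * u.+2).-1 = (h + k.+1 * u.+2).-1.+1 by lia.
  rewrite !binS; lia.
Qed.

(** For [j < r] put [r - j = v + 1] and [M = (k + 1) * r - j - 1]; the count is
    [C(M, v + 1) - k * C(M, v)]. Since [(v + 1) * C(M, v + 1) = (M - v) * C(M, v)] and
    [M - v = r * k], multiplying by [r] leaves [(r - v - 1) * C(M, v + 1)], and [r - v - 1 = j]. *)
Lemma card_dissections_root k r j : 0 < k -> 0 < j <= r -> r * k < n ->
  r * #|dissections n k (r * k) (j * k)| = j * 'C(k.+1 * r - j - 1, r - j).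
Proof.
move=> k0 /andP[j0 jr] rn.
case: (ltngtP j r) jr => // [jr _|-> _]; last first.
  by rewrite subnn bin0 card_dissections0.
have [v vE] : exists v, r - j = v.+1 by exists (r - j).-1; lia.
have rE : r = j + v.+1 by lia.
have := @card_dissections k v (j * k) k0.
have -> : j * k + v.+1 * k = r * k by rewrite rE mulnDl.
move=> /(_ rn).
have -> : (j * k + k.+1 * v.+1).-1 = k.+1 * r - j - 1 by rewrite rE; nia.
rewrite vE; set M := _ - 1.
have := mul_bin_left M v.
have -> : M - v = r * k by rewrite /M rE; nia.
set C1 := 'C(M, v.+1); set C0 := 'C(M, v) => H1 H2.
nia.
Qed.

End Counting.

(** * Convex polygons *)

Section Cyclic.
Local Open Scope nat_scope.
Variable n : nat.
Implicit Types (u v w x y : 'I_n) (S : {set 'I_n}).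

(** Strict counter-clockwise order, in a form invariant under rotating the three arguments. *)
Definition cyc (u v w : nat) : bool :=
  [|| (u < v) && (v < w), (v < w) && (w < u) | (w < u) && (u < v)].

(* The directed edges of the counter-clockwise polygon with vertex set [S]. *)
Definition side S u v :=
  [&& u \in S, v \in S, u != v &
      [forall w in S, (w != u) && (w != v) ==> cyc u v w]].

Lemma sideP S u v :
  reflect [/\ u \in S, v \in S, u != v &
             forall w, w \in S -> w != u -> w != v -> cyc u v w] (side S u v).
Proof.
apply: (iffP and4P) => [[? ? ? /forall_inP H]|[? ? ? H]]; split => //.
  by move=> w /H/implyP Hw wu wv; apply: Hw; rewrite wu.
by apply/forall_inP => w wS; apply/implyP => /andP[]; apply: H.
Qed.

Lemma cyc_total u v w : u != v -> v != w -> u != w -> cyc u v w || cyc u w v.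
Proof. rewrite -!(inj_eq val_inj) /cyc /=; lia. Qed.

Lemma side_next S u : 1 < #|S| -> u \in S -> side S u (next (enum S) u).
Proof.
move=> S1 uS.
have sS : sorted (fun x y => x < y) (enum S).
  rewrite (_ : enum S = [seq x <- enum 'I_n | x \in S]); last by rewrite enumT.
  apply: sorted_filter; first by move=> ? ? ?; apply: ltn_trans.
  by have := iota_ltn_sorted 0 n; rewrite -val_enum_ord sorted_map.
have pS : pairwise (fun x y => x < y) (enum S).
  by rewrite -sorted_pairwise // => ? ? ?; apply: ltn_trans.
have : u \in enum S by rewrite mem_enum.
have memS w : w \in S = (w \in enum S) by rewrite mem_enum.
have unS := enum_uniq (mem S).
rewrite cardE in S1.
move=> uE; move: uE memS unS S1 pS => /splitPr[s1 s2] memS unS S1.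
rewrite -(next_rot (size s1)) // rot_size_cat /=.
rewrite pairwise_cat /= => /and3P[/allrelP H12 p1 /andP[/allP u2 p2]].
case: s2 => [|y s2] in memS unS S1 H12 u2 p2 *.
  case: s1 => [|y s1] //= in memS unS S1 H12 p1 *.
  rewrite eqxx; have yu : y < u by apply: H12; rewrite !inE eqxx.
  apply/sideP; split; rewrite ?memS ?inE ?mem_cat ?inE ?eqxx ?orbT //.
    by rewrite -(inj_eq val_inj) /=; lia.
  move=> w; rewrite memS !inE mem_cat !inE orbC => /orP[/orP[w1|/eqP->]|/eqP->]; rewrite ?eqxx //.
  have yw : y < w by case/andP: p1 => /allP/(_ w w1).
  have wu : w < u by apply: H12; rewrite !inE ?w1 ?orbT.
  by rewrite /cyc yw wu orbT.
rewrite /= eqxx; have uy : u < y by apply: u2; rewrite !inE eqxx.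
apply/sideP; split; rewrite ?memS ?inE ?mem_cat ?inE ?eqxx ?orbT //.
  by rewrite -(inj_eq val_inj) /=; lia.
move=> w; rewrite memS mem_cat !inE => /or4P[w1|/eqP->|/eqP->|w2]; rewrite ?eqxx //.
  by have wu : w < u by [apply: H12; rewrite ?inE ?eqxx]; rewrite /cyc wu uy !orbT.
by have yw : y < w by [case/andP: p2 => /allP/(_ w w2)]; rewrite /cyc yw uy.
Qed.

Lemma side_inj S u v v' : side S u v -> side S u v' -> v = v'.
Proof.
move=> /sideP[uS vS uv Hv] /sideP[_ v'S uv' Hv']; apply/eqP/negP => /negP vv'.
have := Hv v' v'S; have := Hv' v vS; rewrite ![_ == u]eq_sym uv uv' vv' eq_sym vv'.
by move=> /(_ isT isT) h1 /(_ isT isT); move: h1; rewrite /cyc; clear; lia.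
Qed.

Lemma side_prev S v : 1 < #|S| -> v \in S -> exists u, side S u v.
Proof.
move=> S1 vS; exists (prev (enum S) v).
have := @side_next S (prev (enum S) v) S1; rewrite -mem_enum mem_prev mem_enum.
by move/(_ vS); rewrite next_prev // enum_uniq.
Qed.

Lemma side_third S u v : 2 < #|S| -> side S u v -> side S v u -> False.
Proof.
move=> S2 /sideP[uS vS uv H1] /sideP[_ _ _ H2].
have : 0 < #|S :\ u :\ v|.
  have vS' : v \in S :\ u by rewrite in_setD1 eq_sym uv.
  by move: S2; rewrite (cardsD1 u) uS (cardsD1 v) vS' !add1n.
case/card_gt0P => w; rewrite !inE => /and3P[wv wu wS].
by have := H1 w wS wu wv; have := H2 w wS wv wu; rewrite /cyc; lia.
Qed.

(** Of the two sides at [v], at most one has [u] as its other end. With respect to the side found,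
    [orient] vanishes at [p v] and is positive at [p u], which isolates the weight of [p u] in a
    combination of the two. *)
Lemma side_avoid S u v : 2 < #|S| -> u \in S -> v \in S -> u != v ->
  exists x y, [/\ side S x y, (v == x) || (v == y), u != x & u != y].
Proof.
move=> S2 uS vS uv; have S1 := ltnW S2.
case: (eqVneq u (next (enum S) v)) => [E|N]; last first.
  by exists v, (next (enum S) v); split; rewrite ?eqxx ?side_next.
have [w wv] := side_prev S1 vS.
exists w, v; split; rewrite ?eqxx ?orbT //; apply/eqP => uw; subst w.
by apply: (side_third S2 wv); rewrite E side_next.
Qed.

End Cyclic.

Section Orientation.
Variable R : realType.
Implicit Types (a b c d z : R * R) (s t : R).

Lemma orient_segment a b c d t :
  orient a b ((1 - t) *: c + t *: d) = (1 - t) * orient a b c + t * orient a b d.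
Proof.
rewrite /orient.
have -> : ((1 - t) *: c + t *: d).1 = (1 - t) * c.1 + t * d.1 by [].
have -> : ((1 - t) *: c + t *: d).2 = (1 - t) * c.2 + t * d.2 by [].
by ring.
Qed.

Lemma orient_rot a b c : orient a b c = orient b c a.
Proof. by rewrite /orient; ring. Qed.

Lemma orient_swap a b c : orient a c b = - orient a b c.
Proof. by rewrite /orient; ring. Qed.

Lemma orient_swap12 a b c : orient b a c = - orient a b c.
Proof. by rewrite /orient; ring. Qed.

Lemma orient_id1 a b : orient a b a = 0.
Proof. by rewrite /orient; ring. Qed.

Lemma orient_id2 a b : orient a b b = 0.
Proof. by rewrite /orient; ring. Qed.

Lemma segmentP a b z :
  segment a b z <-> exists t, [/\ 0 <= t, t <= 1 & z = (1 - t) *: a + t *: b].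
Proof.
rewrite /segment /=; split => [[t]|[t [t0 t1 ->]]].
  by rewrite in_itv /= => /andP[t0 t1] <-; exists t.
by exists t; rewrite ?in_itv /= ?t0.
Qed.

Lemma segment_sym a b : segment a b = segment b a.
Proof.
suff sub c d : (segment c d `<=` segment d c)%classic.
  by apply/seteqP; split.
move=> z /segmentP[t [t0 t1 ->]]; apply/segmentP; exists (1 - t).
split; [lra|lra|]; rewrite addrC; congr (_ *: _ + _); lra.
Qed.

Lemma segment_left a b : segment a b a.
Proof. by apply/segmentP; exists 0; rewrite subr0 scale1r scale0r addr0; split => //; lra. Qed.

Lemma line_param a b z : a != b -> orient a b z = 0 ->
  exists t, z = (1 - t) *: a + t *: b.
Proof.
case: a b z => [a1 a2] [b1 b2] [z1 z2]; rewrite /orient /= => ab H.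
have comb t : (1 - t) *: (a1, a2) + t *: (b1, b2) =
  ((1 - t) * a1 + t * b1, (1 - t) * a2 + t * b2) by [].
case: (eqVneq a1 b1) => [E|N].
  have N : b2 - a2 != 0.
    by apply: contraNneq ab => H2; rewrite E (_ : a2 = b2) //; lra.
  subst b1; exists ((z2 - a2) / (b2 - a2)); rewrite comb; congr pair; last by field.
  have : (z1 - a1) * (b2 - a2) = 0 by lra.
  by move/eqP; rewrite mulf_eq0 (negbTE N) orbF => /eqP H2; lra.
have {}N : b1 - a1 != 0 by rewrite subr_eq0 eq_sym.
exists ((z1 - a1) / (b1 - a1)); rewrite comb; congr pair; first by field.
apply: (mulfI N); rewrite (_ : _ * (_ + _) = (b1 - a1) * a2 + (z1 - a1) * (b2 - a2)); last by field.
lra.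
Qed.

Lemma segments_cross a b c d :
  orient a c b < 0 -> 0 < orient a c d -> 0 < orient b d a -> orient b d c < 0 ->
  exists2 z, segment a c z & segment b d z.
Proof.
move=> acb acd bda bdc.
(* The zero of the affine function [orient a c] along the segment from [b] to [d]. *)
pose t := orient a c b / (orient a c b - orient a c d).
have dlt : orient a c b - orient a c d < 0 by lra.
have t01 : 0 <= t <= 1.
  rewrite /t -[_ / _]opprK -mulrN -invrN; apply/andP; split.
    by rewrite oppr_ge0 mulr_le0_ge0 ?invr_ge0; lra.
  rewrite -mulNr ler_pdivrMr; lra.
pose z := (1 - t) *: b + t *: d.
have oz : orient a c z = 0.
  by rewrite orient_segment /t; field; lra.
have ac : a != c by apply: contraTneq acb => ->; rewrite /orient; apply/negP; lra.
have [s zE] := line_param ac oz.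
have : orient b d z = 0 by rewrite /z orient_segment orient_id1 orient_id2; lra.
rewrite zE orient_segment => H.
exists z.
  by apply/segmentP; exists s; split => //; nra.
by case/andP: t01 => t0 t1; apply/segmentP; exists t.
Qed.

End Orientation.

Section Polygon.
Variables (R : realType) (n : nat) (p : 'I_n -> R * R).
Hypothesis hccw : ccw_labelled p.
Implicit Types (u v w x y : 'I_n) (S : {set 'I_n}) (z : R * R).

(** The open polygon as an intersection of half-planes, so that membership, convexity and openness
    reduce to signs of [orient]. *)
Definition cell S : set (R * R) :=
  [set z | forall u v, side S u v -> 0 < orient (p u) (p v) z]%classic.

Definition closed_cell S : set (R * R) :=
  [set z | forall u v, side S u v -> 0 <= orient (p u) (p v) z]%classic.

Lemma orient_cyc u v w : cyc u v w -> 0 < orient (p u) (p v) (p w).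
Proof.
case/or3P => /andP[h1 h2].
- exact: hccw.
- by rewrite orient_rot; apply: hccw.
- by rewrite -orient_rot; apply: hccw.
Qed.

Lemma orient_cycN u v w : cyc u v w -> orient (p u) (p w) (p v) < 0.
Proof. by move=> /orient_cyc; rewrite orient_swap oppr_gt0. Qed.

Lemma side_point_ge0 S u v w : side S u v -> w \in S -> 0 <= orient (p u) (p v) (p w).
Proof.
case/sideP => uS vS uv H wS.
case: (eqVneq w u) => [->|wu]; first by rewrite orient_id1.
case: (eqVneq w v) => [->|wv]; first by rewrite orient_id2.
by apply/ltW/orient_cyc/H.
Qed.

Lemma cell_sub S : (cell S `<=` closed_cell S)%classic.
Proof. by move=> z H u v /H/ltW. Qed.

Lemma closed_cell_segment S u v z : (2 < #|S|)%N -> u \in S -> v \in S -> u != v ->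
  closed_cell S z -> orient (p u) (p v) z = 0 -> segment (p u) (p v) z.
Proof.
move=> S2 uS vS uv zS oz.
(* A point beyond [v'] on the ray from [u'] violates the inequality of a side at [v'] that avoids
   [u']. Exchanging the two vertices gives the other bound on [t]. *)
have avoid u' v' t : u' \in S -> v' \in S -> u' != v' ->
    z = (1 - t) *: p u' + t *: p v' -> t <= 1.
  move=> uS' vS' uv' zE; have [x [y [xy vxy ux uy]]] := side_avoid S2 uS' vS' uv'.
  have := zS _ _ xy; rewrite zE orient_segment.
  have -> : orient (p x) (p y) (p v') = 0.
    by case/orP: vxy => /eqP->; rewrite ?orient_id1 ?orient_id2.
  have : 0 < orient (p x) (p y) (p u').
    by case/sideP: xy => _ _ _ H; apply/orient_cyc/H.
  nra.
have puv : p u != p v.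
  have [x [y [xy vxy ux uy]]] := side_avoid S2 uS vS uv.
  have : 0 < orient (p x) (p y) (p u).
    by case/sideP: xy => _ _ _ H; apply/orient_cyc/H.
  apply: contraTneq => ->.
  by case/orP: vxy => /eqP->; rewrite ?orient_id1 ?orient_id2 ltxx.
have [t zE] := line_param puv oz.
apply/segmentP; exists t; split => //; last exact: avoid zE.
have : 1 - t <= 1; last lra.
apply: (avoid v u) => //; first by rewrite eq_sym.
by rewrite zE addrC; congr (_ *: _ + _); lra.
Qed.

Lemma side_segment_closed S u v z : side S u v -> segment (p u) (p v) z ->
  closed_cell S z /\ orient (p u) (p v) z = 0.
Proof.
move=> uv /segmentP[t [t0 t1 ->]]; split; last first.
  by rewrite orient_segment orient_id1 orient_id2; lra.
move=> x y xy; rewrite orient_segment.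
have [uS vS _ _] := sideP _ _ _ uv.
have := side_point_ge0 xy uS; have := side_point_ge0 xy vS; nra.
Qed.

Lemma point_on_segment u v w : segment (p u) (p v) (p w) -> u != v -> (w == u) || (w == v).
Proof.
move=> /segmentP[t [_ _ E]] uv; case: (eqVneq w u) => //= wu; apply/negP => /negP wv.
have : orient (p u) (p v) (p w) = 0 by rewrite E orient_segment orient_id1 orient_id2; lra.
have := cyc_total uv _ _; move=> /(_ w); rewrite !(eq_sym _ w) => /(_ wv wu).
by case/orP => [/orient_cyc|/orient_cycN]; lra.
Qed.

End Polygon.

Section PlaneTopology.
Variable R : realType.
Implicit Types (a b c z : R * R) (A C K : set (R * R)).
Local Open Scope classical_set_scope.

Lemma orient_continuous a b : continuous (orient a b).
Proof.
move=> z; apply: cvgB; apply: cvgM; try exact: cvg_cst;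
  by apply: cvgB; [apply: cvg_fst || apply: cvg_snd | exact: cvg_cst].
Qed.

Lemma segment_continuous a b : continuous (fun t : R => (1 - t) *: a + t *: b).
Proof.
move=> t; apply: cvgD; apply: cvgZr_tmp; last exact: cvg_id.
by apply: cvgB; [exact: cvg_cst | exact: cvg_id].
Qed.

Lemma connected_segment a b : connected (segment a b).
Proof.
apply: connected_continuous_connected; first exact: segment_connected.
by apply: continuous_subspaceT; exact: segment_continuous.
Qed.

Lemma connected_star A c : A c -> (forall z, A z -> segment c z `<=` A) -> connected A.
Proof.
move=> Ac sA.
have -> : A = \bigcup_(z in A) segment c z.
  apply/seteqP; split => z; first by exists z => //; rewrite segment_sym; apply: segment_left.
  by case=> x Ax; apply: sA.
apply: bigcup_connected; last by move=> z _; apply: connected_segment.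
by exists c => z _; apply: segment_left.
Qed.

(** [C] is relatively open in [A], and relatively closed because [A] meets the closed set [K] in
    [C]; being connected, it is a full component. *)
Lemma connected_component_clopen A C K z : C z -> connected C -> C `<=` A ->
  open C -> closed K -> A `&` K = C -> connected_component A z = C.
Proof.
move=> Cz Cc CA Co Kc AK; apply/seteqP; split; last exact: connected_component_max.
have zA : A z by apply: CA.
have CK : connected_component A z `&` C = connected_component A z `&` K.
  rewrite -AK setIA; congr (_ `&` _); apply: setIidl.
  exact: connected_component_sub.
have -> : connected_component A z = connected_component A z `&` C; last exact: subIsetr.
apply/esym/component_connected.
- by exists z; split => //; apply: connected_component_refl.
- by exists C.
- by exists K.
Qed.

End PlaneTopology.

Section Cells.
Variables (R : realType) (n : nat) (p : 'I_n -> R * R).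
Hypothesis hccw : ccw_labelled p.
Variable S : {set 'I_n}.
Hypothesis S2 : (2 < #|S|)%N.
Implicit Types (u v w x y : 'I_n) (z : R * R).
Local Open Scope classical_set_scope.

Let S1 : (1 < #|S|)%N := ltnW S2.

Lemma cell_open : open (cell p S).
Proof.
rewrite openE => z zS.
have near_side u v : \forall z' \near z, side S u v -> 0 < orient (p u) (p v) z'.
  case uv: (side S u v); last by apply: (@filterE _ (nbhs z)).
  have H : nbhs (orient (p u) (p v) z) [set t | 0 < t].
    by apply: open_nbhs_nbhs; split; [exact: open_gt | exact: zS].
  exact: (@filterS _ (nbhs z) _ _ _ (fun _ h _ => h) (orient_continuous H)).
exact: filter_forall (fun u => filter_forall _ (near_side u)).
Qed.

Lemma closed_cell_closed : closed (closed_cell p S).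
Proof.
have -> : closed_cell p S =
    \bigcap_(e in [set e | side S e.1 e.2]) orient (p e.1) (p e.2) @^-1` [set t | 0 <= t].
  by apply/seteqP; split => z H; [move=> e; apply: H | move=> u v uv; apply: (H (u, v))].
apply: closed_bigI => e _.
have /continuous_closedP H := @orient_continuous R (p e.1) (p e.2).
by apply: H; exact: closed_ge.
Qed.

Lemma cell_segment c z : cell p S c -> closed_cell p S z ->
  forall t, 0 < t -> t <= 1 -> cell p S ((1 - t) *: z + t *: c).
Proof.
move=> cS zS t t0 t1 u v uv; rewrite orient_segment.
have := cS _ _ uv; have := zS _ _ uv; nra.
Qed.

Lemma connected_cell : connected (cell p S).
Proof.
case: (pselect (exists c, cell p S c)) => [[c cS]|N]; last first.
  have -> : cell p S = set0 by apply/seteqP; split => // z zS; case: N; exists z.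
  exact: connected0.
apply: (@connected_star _ _ c) => // z zS x /segmentP[t [t0 t1 ->]] u v uv.
rewrite orient_segment; have := cS _ _ uv; have := zS _ _ uv; nra.
Qed.

Lemma cell_nonempty : cell p S !=set0.
Proof.
pose m : R := #|S|%:R.
have m0 : 0 < m by rewrite ltr0n; lia.
(* The centroid of the vertices: [orient] is affine in its last argument, so its value at [c] is the
   mean of its values at the vertices, which are nonnegative and not all zero. *)
pose c := (m^-1 * \sum_(w in S) (p w).1, m^-1 * \sum_(w in S) (p w).2).
have cE u v : m * orient (p u) (p v) c = \sum_(w in S) orient (p u) (p v) (p w).
  have -> : \sum_(w in S) orient (p u) (p v) (p w) =
      ((p v).1 - (p u).1) * (\sum_(w in S) (p w).2 - m * (p u).2)
      - (\sum_(w in S) (p w).1 - m * (p u).1) * ((p v).2 - (p u).2).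
    rewrite /m -sum1_card natr_sum !mulr_suml -!sumrB mulr_sumr mulr_suml -sumrB.
    by apply: eq_bigr => w _; rewrite !mul1r.
  by rewrite /orient /c /=; field; rewrite gt_eqF.
exists c => u v uv; rewrite -(pmulr_rgt0 _ m0) cE.
have [uS vS nuv H] := sideP _ _ _ uv.
have [w [wS wu wv]] : exists w, [/\ w \in S, w != u & w != v].
  have vS' : v \in S :\ u by rewrite in_setD1 eq_sym nuv.
  have : (0 < #|S :\ u :\ v|)%N.
    by move: S2; rewrite (cardsD1 u) uS (cardsD1 v (S :\ u)) vS' !add1n.
  by case/card_gt0P => w; rewrite !in_setD1 => /and3P[? ? ?]; exists w.
rewrite (bigD1 w) //=; apply: ltr_wpDr.
  by apply: sumr_ge0 => x /andP[xS _]; apply: (side_point_ge0 hccw uv).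
exact/orient_cyc/H.
Qed.

Lemma closure_cell : closure (cell p S) = closed_cell p S.
Proof.
apply/seteqP; split.
  have /closure_id -> := closed_cell_closed; apply: closureS; exact: cell_sub.
have [c cS] := cell_nonempty.
move=> z zS B zB.
have := @segment_continuous R z c 0; rewrite /continuous_at subr0 scale1r scale0r addr0.
move=> /(_ _ zB) /nbhs_ballP[e /= e0 He].
(* Positive, at most 1 and below [e]: moving from [z] towards [c] by this fraction enters the cell
   without leaving [B]. *)
pose t := e / (1 + e).
have t0 : 0 < t by rewrite divr_gt0 //; lra.
have t1 : t <= 1 by rewrite ler_pdivrMr; lra.
have te : t < e by rewrite /t ltr_pdivrMr; nra.
exists ((1 - t) *: z + t *: c); split; first exact: cell_segment.
by apply: He; rewrite /ball /= sub0r normrN gtr0_norm.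
Qed.

Lemma cell_boundary : closure (cell p S) `\` interior (cell p S) =
  [set z | exists u v, side S u v /\ segment (p u) (p v) z].
Proof.
have /interior_id -> := cell_open; rewrite closure_cell.
apply/seteqP; split => z; last first.
  move=> [u [v [uv /(side_segment_closed hccw uv)[zS oz]]]]; split => // /(_ _ _ uv).
  by rewrite oz ltxx.
move=> [zS zN]; apply: contrapT => H; apply: zN => u v uv.
rewrite lt_neqAle (zS _ _ uv) andbT eq_sym; apply/eqP => oz; apply: H.
exists u, v; split => //; have [uS vS nuv _] := sideP _ _ _ uv.
exact: (closed_cell_segment hccw S2).
Qed.

Lemma boundary_segments :
  [set z | exists u v, side S u v /\ segment (p u) (p v) z] =
  \bigcup_(x in [set` enum S]) segment (p x) (p (next (enum S) x)).
Proof.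
apply/seteqP; split => z.
  move=> [u [v [uv Hz]]]; have [uS _ _ _] := sideP _ _ _ uv.
  exists u; first by rewrite /= mem_enum.
  by rewrite -(side_inj uv (side_next S1 uS)).
move=> [u /=]; rewrite mem_enum => uS Hz.
by exists u, (next (enum S) u); split => //; apply: side_next.
Qed.

(* The left-hand side is twice the area of the polygon. *)
Lemma orient_sum z : \sum_(x in S) orient (p x) (p (next (enum S) x)) z =
  \sum_(x in S) orient (p x) (p (next (enum S) x)) 0.
Proof.
have reidx (F : 'I_n -> R) : \sum_(x in S) F (next (enum S) x) = \sum_(x in S) F x.
  have bij := Bijective (prev_next (enum_uniq (mem S))) (next_prev (enum_uniq (mem S))).
  rewrite [RHS](reindex (next (enum S))); last exact: onW_bij.
  by apply: eq_bigl => x; rewrite -[RHS]mem_enum mem_next mem_enum.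
apply/eqP; rewrite -subr_eq0 -sumrB.
rewrite (eq_bigr (fun x => ((p (next (enum S) x)).1 - (p x).1) * z.2
     - z.1 * ((p (next (enum S) x)).2 - (p x).2))); last first.
  by move=> x _; rewrite /orient /=; ring.
rewrite sumrB -mulr_suml -mulr_sumr !sumrB.
by rewrite (reidx (fun x => (p x).1)) (reidx (fun x => (p x).2)) !subrr mul0r mulr0 subrr.
Qed.

(** On the cell the values of [orient] at the sides are positive with constant sum [M], so each is
    at most [M]. By Cramer's rule, the values at two consecutive sides, divided by [d], are affine
    coordinates of [z]. *)
Lemma bounded_cell : bounded_set (cell p S).
Proof.
pose M := \sum_(x in S) orient (p x) (p (next (enum S) x)) 0.
have le_M z u v : cell p S z -> side S u v -> 0 <= orient (p u) (p v) z <= M.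
  move=> zS uv; rewrite ltW ?zS //=; have [uS _ _ _] := sideP _ _ _ uv.
  rewrite /M -(orient_sum z) (bigD1 u) //= -(side_inj uv (side_next S1 uS)) lerDl.
  by apply: sumr_ge0 => x /andP[xS _]; apply/ltW/zS/side_next.
have [u uS] : exists u, u \in S by apply/card_gt0P; exact: ltnW.
set v := next (enum S) u; have uv : side S u v := side_next S1 uS.
have [_ vS _ H] := sideP _ _ _ uv.
set w := next (enum S) v; have vw : side S v w := side_next S1 vS.
have [_ wS nvw _] := sideP _ _ _ vw.
have wu : w != u by apply/eqP => E; apply: (side_third S2 uv); rewrite -E.
have d0 : 0 < orient (p u) (p v) (p w) by apply/orient_cyc/H => //; rewrite eq_sym.
set d := orient (p u) (p v) (p w) in d0.
exists (`|p v| + M / d * `|p v - p u| + M / d * `|p w - p v|); split; first exact: num_real.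
move=> B /ltW ltB z zS; apply: le_trans ltB.
have zE : z = p v - (orient (p v) (p w) z / d) *: (p v - p u)
    + (orient (p u) (p v) z / d) *: (p w - p v).
  have dn0 : d != 0 by rewrite gt_eqF.
  move: dn0; rewrite /d /orient.
  case: (p u) (p v) (p w) z {zS} => [u1 u2] [v1 v2] [w1 w2] [z1 z2] /= dn0.
  by congr pair => /=; rewrite /GRing.scale /=; field.
rewrite zE.
have h1 := le_M z _ _ zS uv; have h2 := le_M z _ _ zS vw.
have nle (t : R) a : 0 <= t <= M -> `|(t / d) *: a| <= M / d * `|a|.
  move=> /andP[t0 tM]; rewrite normrZ ger0_norm ?divr_ge0 ?(ltW d0) //.
  by rewrite ler_wpM2r // ler_wpM2r // invr_ge0 ltW.
apply: le_trans (ler_normD _ _) _; apply: lerD; last exact: nle.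
by apply: le_trans (ler_normB _ _) _; apply: lerD => //; apply: nle.
Qed.

End Cells.

(** * Faces *)

Section FaceVertices.
Local Open Scope nat_scope.
Variables (n : nat) (D : {set 'I_n * 'I_n}).
Hypothesis ncD : noncrossing D.
Hypothesis dD : forall e : 'I_n * 'I_n, e \in D -> e.1.+1 < e.2.
Implicit Types (u v w x y : 'I_n) (e : 'I_n * 'I_n).

Lemma face_bounds e w : w \in face D e -> e.1 <= w <= e.2.
Proof. by rewrite inE => /and3P[-> ->]. Qed.

Lemma face_left e : e \in D -> e.1 \in face D e.
Proof.
move=> /dD eD; rewrite inE leqnn /=; apply/andP; split; first lia.
by apply/coveredP => -[f _ [h1 _ h2 _]]; have := leq_ltn_trans h1 h2; rewrite ltnn.
Qed.

Lemma face_right e : e \in D -> e.2 \in face D e.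
Proof.
move=> /dD eD; rewrite inE leqnn /= andbC; apply/andP; split; last lia.
by apply/coveredP => -[f _ [_ h1 _ h2]]; have := leq_trans h2 h1; rewrite ltnn.
Qed.

(** [e.1] and [e.2] are the least and the greatest vertex of the face of [e]. *)
Lemma face_inj e f : e \in D -> f \in D -> face D e = face D f -> e = f.
Proof.
case: e f => [a b] [c d] eD fD E.
have := face_left fD; have := face_right fD; rewrite -E => dE cE.
have := face_left eD; have := face_right eD; rewrite E => bF aF.
have /= := (face_bounds aF, face_bounds bF, face_bounds cE, face_bounds dE).
by case=> [[[? ?] ?] ?]; congr pair; apply: val_inj => /=; lia.
Qed.

Lemma face_adjacent e u v : u \in face D e -> v \in face D e -> u < v ->
  (forall w, w \in face D e -> u < w -> w < v -> False) ->
  v = u.+1 :> nat \/ (u, v) \in D :\ e.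
Proof. by apply: vis_adjacent; apply: noncrossingS ncD; apply: subsetDl. Qed.

(** Without a visible vertex strictly inside the arc, the ends of [e] would be consecutive vertices
    or joined by a member of [D] other than [e]. *)
Lemma face_card e : e \in D -> 2 < #|face D e|.
Proof.
move=> eD; have ab := dD eD.
have [w [wf aw wb]] : exists w, [/\ w \in face D e, e.1 < w & w < e.2].
  apply: contrapT => H.
  have [|w wf aw wb|E|] := face_adjacent (face_left eD) (face_right eD).
  - lia.
  - by apply: H; exists w.
  - by rewrite E ltnn in ab.
  - by rewrite -surjective_pairing !inE eqxx.
have : [set e.1; w; e.2] \subset face D e.
  by apply/fintype.subsetP => x; rewrite !finset.in_setU !finset.in_set1 => /orP[/orP[]|] /eqP->;
    rewrite ?wf ?face_left ?face_right.
move/subset_leq_card; apply: leq_trans.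
rewrite finset.setUC cardsU1 cards2 !inE -!(inj_eq val_inj) /=.
have -> : (e.1 == w :> nat) = false by lia.
have -> : (e.2 == w :> nat) = false by lia.
by have -> : (e.2 == e.1 :> nat) = false by lia.
Qed.

Lemma side_faceP e u v : e \in D -> side (face D e) u v ->
  (u, v) = (e.2, e.1) \/ u < v /\ (v = u.+1 :> nat \/ (u, v) \in D :\ e).
Proof.
move=> eD /sideP[uf vf uv H]; case: (ltnP u v) => [ltuv|leuv]; [right|left].
  split=> //; apply: face_adjacent => // w wf uw wv.
  have := H w wf; rewrite -!(inj_eq val_inj) /cyc /=; move: uw wv; clear; lia.
have ltvu : v < u by rewrite ltn_neqAle leuv eq_sym (inj_eq val_inj) uv.
have [/andP[ua ub] /andP[va vb]] := (face_bounds uf, face_bounds vf).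
have Ha := H _ (face_left eD); have Hb := H _ (face_right eD).
congr pair; apply/eqP/negP => /negP N.
- move: Hb; rewrite eq_sym N => /(_ isT); case: (eqVneq e.2 v) => [E|_ /(_ isT)].
    by have := leq_trans ltvu ub; rewrite E ltnn.
  by move: ltvu ub; rewrite /cyc; clear; lia.
- move: Ha; rewrite [e.1 == v]eq_sym N; case: (eqVneq e.1 u) => [E|_ /(_ isT isT)].
    by have := leq_ltn_trans va ltvu; rewrite E ltnn.
  by move: ltvu va; rewrite /cyc; clear; lia.
Qed.

Lemma side_face_outer e : e \in D -> side (face D e) e.2 e.1.
Proof.
move=> eD; have ab := dD eD; apply/sideP; split; rewrite ?face_left ?face_right //.
  by rewrite -(inj_eq val_inj) /=; lia.
move=> w /face_bounds /andP[aw wb]; rewrite -!(inj_eq val_inj) /cyc /= => wb' wa'.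
by lia.
Qed.

Lemma face_max_below e x : e \in D -> e.1 <= x ->
  exists u, [/\ u \in face D e, u <= x & forall w, w \in face D e -> w <= x -> w <= u].
Proof.
move=> eD ax; have Pa : (e.1 \in face D e) && (e.1 <= x) by rewrite face_left.
case: (@arg_maxnP _ e.1 (fun u => (u \in face D e) && (u <= x)) (@nat_of_ord n) Pa) =>
  u /andP[uf ux] umax.
by exists u; split => // w wf wx; apply: umax; rewrite wf.
Qed.

Lemma face_min_above e y : e \in D -> y <= e.2 ->
  exists v, [/\ v \in face D e, y <= v & forall w, w \in face D e -> y <= w -> v <= w].
Proof.
move=> eD yb; have Pb : (e.2 \in face D e) && (y <= e.2) by rewrite face_right.
case: (@arg_minnP _ e.2 (fun u => (u \in face D e) && (y <= u)) (@nat_of_ord n) Pb) =>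
  v /andP[vf yv] vmin.
by exists v; split => // w wf wy; apply: vmin; rewrite wf.
Qed.

(* [w] lies on the closed counter-clockwise arc from [u] to [v]. *)
Definition behind (u v w : 'I_n) := [|| w == u, w == v | cyc u w v].

(** This separates every edge from the face of [e]. If the edge lies inside the arc of [e] and
    differs from [e], no face vertex is strictly between [x] and [y], and the nearest face vertices
    on either side form the required side. Otherwise, as nothing crosses [e], both ends lie on the
    complementary closed arc, and the side is [e] traversed backwards. *)
Lemma face_behind e x y : e \in D -> x < y -> y = x.+1 :> nat \/ (x, y) \in D ->
  exists u v, [/\ side (face D e) u v, behind u v x & behind u v y].
Proof.
move=> eD xy xyE; have ab := dD eD.
case: (boolP ((e.1 <= x) && (y <= e.2) && ((x, y) != e))) => [/andP[/andP[ax yb] xye]|out].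
  have nxy w : w \in face D e -> x < w -> w < y -> False.
    move=> wf xw wy; case: xyE => [|xyD]; first lia.
    move: wf; rewrite inE => /and3P[_ _ /negP]; apply.
    by apply/coveredP; exists (x, y); rewrite ?inE ?xye.
  have [u [uf ux umax]] := face_max_below eD ax.
  have [v [vf yv vmin]] := face_min_above eD yb.
  exists u, v; split; rewrite /behind -?(inj_eq val_inj) /cyc /=; try lia.
  apply/sideP; split => //; first by rewrite -(inj_eq val_inj) /=; lia.
  move=> w wf; rewrite -!(inj_eq val_inj) /cyc /= => wu wv.
  have h1 := umax w wf; have h2 := vmin w wf; have h3 := nxy w wf.
  case: (leqP w x) => wx; first by have := h1 wx; lia.
  by case: (leqP y w) => wy; [have := h2 wy; lia | case: h3].
exists e.2, e.1; split; first exact: side_face_outer.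
all: rewrite /behind -!(inj_eq val_inj) /cyc /=.
all: case: (eqVneq (x, y) e) out => [<- _|_]; rewrite ?andbT /=; first lia.
all: rewrite negb_and -!ltnNge => out.
all: have nc1 : x < e.1 -> y <= e.1 \/ e.2 <= y.
all: try by [move=> xa; case: xyE => [|xyD]; [lia|];
   case: (leqP y e.1) => ya; [by left|right]; rewrite leqNgt; apply/negP => yb;
   apply: (noncrossingP _ ncD (x, y) e)].
all: have nc2 : e.2 < y -> x <= e.1 \/ e.2 <= x.
all: try by [move=> yb; case: xyE => [|xyD]; [lia|];
   case: (leqP x e.1) => ax; [by left|right]; rewrite leqNgt; apply/negP => xb;
   apply: (noncrossingP _ ncD e (x, y))].
all: by case/orP: out => h; [have := nc1 h|have := nc2 h]; lia.
Qed.

End FaceVertices.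

Section EdgeSets.
Local Open Scope nat_scope.
Variable n : nat.
Implicit Types (E : {set {set 'I_n}}) (u v w x y : 'I_n).

Definition diagonal_set E : {set 'I_n * 'I_n} :=
  [set e : 'I_n * 'I_n | (e.1.+1 < e.2) && ([set e.1; e.2] \in E)]%SET.

Definition has_hull E := forall i : 'I_n, [set i; ordS i]%SET \in E.

Lemma diagonal_setP E e : e \in diagonal_set E -> e.1.+1 < e.2.
Proof. by rewrite inE => /andP[]. Qed.

Lemma diagonal_setE E x y : ((x, y) \in diagonal_set E) = (x.+1 < y) && ([set x; y]%SET \in E).
Proof. by rewrite inE. Qed.

Lemma val_ordS (i : 'I_n) : ordS i = (if i.+1 == n then 0 else i.+1) :> nat.
Proof.
rewrite /=; case: eqP => [->|/eqP ne]; first by rewrite modnn.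
by rewrite modn_small // ltn_neqAle ne ltn_ord.
Qed.

Lemma side_ordS u : 2 < n -> side [set: 'I_n]%SET u (ordS u).
Proof.
move=> n2; have un := ltn_ord u; have vn := val_ordS u.
apply/sideP; split; rewrite ?finset.in_setT //.
  rewrite -(inj_eq val_inj) -[val (ordS u)]/(nat_of_ord (ordS u)) vn /=.
  by case: (u.+1 =P n) => /=; lia.
move=> w _; rewrite -!(inj_eq val_inj) -[val (ordS u)]/(nat_of_ord (ordS u)) /cyc vn /=.
by have := ltn_ord w; case: (u.+1 =P n) => /=; lia.
Qed.

Lemma set2_inj x y x' y' : x < y -> x' < y' -> [set x; y]%SET = [set x'; y']%SET ->
  x = x' /\ y = y'.
Proof.
move=> xy xy' /setP E.
have := E x; have := E y; have := E x'; have := E y'.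
rewrite !inE -!(inj_eq val_inj) /= !eqxx ?orbT => h1 h2 h3 h4.
by split; apply: val_inj => /=; lia.
Qed.

Lemma edge_cases E e : simple_graph E -> e \in E ->
  exists x y, [/\ x < y, e = [set x; y]%SET & y = x.+1 :> nat \/ (x, y) \in diagonal_set E].
Proof.
move=> sE eE; have /eqP/cards2P[x [y [xy eE']]] := sE e eE.
case: (ltngtP x y) => [lt_xy|lt_yx|/val_inj E']; last by rewrite E' eqxx in xy.
  by exists x, y; split => //; rewrite diagonal_setE -eE' eE andbT; lia.
exists y, x; rewrite finset.setUC; split => //.
by rewrite diagonal_setE finset.setUC -eE' eE andbT; lia.
Qed.

Lemma adjacent_cases E x y : has_hull E -> x < y ->
  y = x.+1 :> nat \/ (x, y) \in diagonal_set E -> [set x; y]%SET \in E.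
Proof.
move=> hE xy [yx|]; last by rewrite diagonal_setE => /andP[].
have := hE x; have -> : ordS x = y.
  by apply: val_inj; rewrite -[LHS]/(nat_of_ord (ordS x)) val_ordS -yx ltn_eqF.
by [].
Qed.

End EdgeSets.

Section Faces.
Variables (R : realType) (n : nat) (p : 'I_n -> R * R).
Hypothesis hccw : ccw_labelled p.
Hypothesis n2 : (2 < n)%N.
Variable E : {set {set 'I_n}}.
Hypothesis sE : simple_graph E.
Hypothesis hE : has_hull E.
Let D := diagonal_set E.
Hypothesis ncD : noncrossing D.
Implicit Types (u v w x y : 'I_n) (z : R * R) (e : 'I_n * 'I_n).
Local Open Scope classical_set_scope.

Let dD e : e \in D -> (e.1.+1 < e.2)%N := @diagonal_setP n E e.

Lemma cardT : (2 < #|[set: 'I_n]%SET|)%N.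
Proof. by rewrite cardsT card_ord. Qed.

Lemma drawingP z : drawing p E z <->
  exists x y, [/\ (x < y)%N, [set x; y]%SET \in E & segment (p x) (p y) z].
Proof.
split; last first.
  move=> [x [y [_ xyE Hz]]]; right; exists [set x; y]%SET => //.
  by exists x, y.
have edge (e : {set 'I_n}) z' : e \in E -> edge_segment p e z' ->
    exists x y, [/\ (x < y)%N, [set x; y]%SET \in E & segment (p x) (p y) z'].
  move=> eE [x [y [eE' Hz]]]; have c2 := sE eE.
  case: (ltngtP x y) => [xy|yx|/val_inj xy].
  - by exists x, y; rewrite -eE'.
  - by exists y, x; rewrite finset.setUC -eE' segment_sym.
  - by move: c2; rewrite eE' xy finset.setUid cards1.
case=> [[i _ <-]|[e /= eE]]; last exact: edge.
apply: (edge _ _ (hE i)); exists i, (ordS i); split => //; exact: segment_left.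
Qed.

Lemma drawing_sub_hull : drawing p E `<=` closed_cell p [set: 'I_n]%SET.
Proof.
move=> z /drawingP[x [y [_ _ /segmentP[t [t0 t1 ->]]]]] u v uv; rewrite orient_segment.
have := side_point_ge0 hccw uv (finset.in_setT x).
have := side_point_ge0 hccw uv (finset.in_setT y); nra.
Qed.

Lemma behind_orient u v w : behind u v w -> orient (p u) (p v) (p w) <= 0.
Proof.
case/or3P => [/eqP->|/eqP->|/(orient_cycN hccw)/ltW //].
  by rewrite orient_id1.
by rewrite orient_id2.
Qed.

Lemma cell_face_drawing e : e \in D -> cell p (face D e) `<=` ~` drawing p E.
Proof.
move=> eD z zS /drawingP[x [y [xy xyE /segmentP[t [t0 t1 zE]]]]].
have adj : y = x.+1 :> nat \/ (x, y) \in D.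
  by rewrite /D diagonal_setE xyE andbT; lia.
have [u [v [uv ux uy]]] := face_behind ncD dD eD xy adj.
have := zS _ _ uv; rewrite zE orient_segment.
have := behind_orient ux; have := behind_orient uy; nra.
Qed.

Lemma side_edge e u v : e \in D -> side (face D e) u v -> [set u; v]%SET \in E.
Proof.
move=> eD /(side_faceP ncD dD eD)[[-> ->]|[uv H]].
  by rewrite finset.setUC; move: eD; rewrite inE => /andP[].
by apply: adjacent_cases => //; case: H => [|/setD1P[]]; [left|right].
Qed.

Lemma side_drawing e u v : e \in D -> side (face D e) u v ->
  segment (p u) (p v) `<=` drawing p E.
Proof.
move=> eD uv z zuv; right; exists [set u; v]%SET; first exact: side_edge uv.
by exists u, v.
Qed.

(** The boundary of the cell consists of edges, so off the drawing the closed cell is no larger than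
    the open one. *)
Lemma cell_face_component e z : e \in D -> cell p (face D e) z ->
  connected_component (~` drawing p E) z = cell p (face D e).
Proof.
move=> eD zS; have S2 := face_card ncD dD eD.
apply: (@connected_component_clopen _ _ _ (closed_cell p (face D e))) => //.
- exact: connected_cell.
- exact: cell_face_drawing.
- exact: cell_open.
- exact: closed_cell_closed.
- apply/seteqP; split => x; last first.
    by move=> xS; split; [exact: cell_face_drawing xS | exact: cell_sub].
  move=> [xN xS]; apply: contrapT => xN'.
  have : (closure (cell p (face D e)) `\` interior (cell p (face D e))) x.
    by rewrite closure_cell //; split => // /interior_subset.
  rewrite cell_boundary // => -[u [v [uv]]].
  by move/(side_drawing eD uv).
Qed.

Lemma outer_unbounded z : ~ drawing p E z -> ~ cell p [set: 'I_n]%SET z ->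
  ~ bounded_set (connected_component (~` drawing p E) z).
Proof.
move=> zN zT.
have [u [v [uv ozle]]] : exists u v, side [set: 'I_n]%SET u v /\ orient (p u) (p v) z <= 0.
  apply: contrapT => H; apply: zT => u v uv; rewrite ltNge; apply/negP => oz.
  by apply: H; exists u, v.
have [uT vT nuv H] := sideP _ _ _ uv.
have [w [wu wv]] : exists w, w != u /\ w != v.
  have vS' : v \in [set: 'I_n]%SET :\ u by rewrite in_setD1 eq_sym nuv finset.in_setT.
  have : (0 < #|[set: 'I_n]%SET :\ u :\ v|)%N.
    by move: cardT; rewrite (cardsD1 u) uT (cardsD1 v (_ :\ u)) vS' !add1n.
  by case/card_gt0P => w; rewrite !in_setD1 => /and3P[? ? ?]; exists w.
have ow : 0 < orient (p u) (p v) (p w) by apply/(orient_cyc hccw)/H; rewrite ?finset.in_setT.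
pose d := p u - p w.
(* Since [p w] is strictly to the left of the side from [u] to [v], [orient] decreases in the
   direction [d], and the ray never meets the hull after its start. *)
pose ray : set (R * R) := [set z + s *: d | s in [set s | 0 <= s]].
have oray s : orient (p u) (p v) (z + s *: d) =
    orient (p u) (p v) z - s * orient (p u) (p v) (p w).
  rewrite /d /orient; case: (p u) (p v) (p w) z {zN zT ozle d ray ow} => [? ?] [? ?] [? ?] [? ?] /=.
  by rewrite /GRing.scale /=; ring.
have ray_sub : ray `<=` connected_component (~` drawing p E) z.
  apply: connected_component_max.
  - by exists 0 => //=; rewrite scale0r addr0.
  - move=> _ [s /= s0 <-]; case: (eqVneq s 0) => [->|sN]; first by rewrite scale0r addr0.
    have {}s0 : 0 < s by rewrite lt_neqAle eq_sym sN.
    move=> /drawing_sub_hull/(_ u v uv); rewrite oray; nra.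
  - apply: (@connected_star _ _ z); first by exists 0 => //=; rewrite scale0r addr0.
    move=> _ [s /= s0 <-] _ /segmentP[t [t0 t1 ->]]; exists (t * s) => /=; first exact: mulr_ge0.
    by rewrite [t *: (z + _)]scalerDr addrA -scalerDl subrK scale1r scalerA.
move=> /pinfty_ex_gt0[M M0 HM].
have d0 : 0 < `|d|.
  rewrite normr_gt0 /d subr_eq0; apply: contraTneq ow => ->.
  by rewrite orient_id1 ltxx.
(* At this parameter the ray is at distance [M + |z| + 1] from [z], hence has norm at least
   [M + 1]. *)
have s0 : 0 <= (M + `|z| + 1) / `|d| by rewrite divr_ge0 //; have := normr_ge0 z; lra.
have rs : ray (z + ((M + `|z| + 1) / `|d|) *: d) by exists ((M + `|z| + 1) / `|d|).
have /= := HM _ (ray_sub _ rs).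
have := ler_normB (z + ((M + `|z| + 1) / `|d|) *: d) z.
rewrite addrAC subrr add0r normrZ ger0_norm // mulfVK ?gt_eqF //; lra.
Qed.

Lemma on_chord u v z : u != v -> cell p [set: 'I_n]%SET z ->
  orient (p u) (p v) z = 0 -> segment (p u) (p v) z.
Proof.
move=> uv zT; apply: (closed_cell_segment hccw cardT); rewrite ?finset.in_setT //.
exact: cell_sub.
Qed.

(** Among the members of [D] that have [z] below them, the outer side being one, take the one with
    the shortest arc. Any other member of [D] bounding its face has a shorter arc, so [z] is not
    below it; the remaining sides are hull sides. *)
Lemma point_location z : ~ drawing p E z -> cell p [set: 'I_n]%SET z ->
  exists2 e, e \in D & cell p (face D e) z.
Proof.
move=> zN zT.
have n0 : (0 < n)%N by lia.
pose i0 : 'I_n := Ordinal n0.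
have im : (n.-1 < n)%N by lia.
pose m : 'I_n := Ordinal im.
have mE : ordS m = i0.
  by apply: val_inj; rewrite -[LHS]/(nat_of_ord (ordS m)) val_ordS /= prednK // eqxx.
have D0 : (i0, m) \in D.
  rewrite diagonal_setE finset.setUC -{2}mE hE andbT /=; lia.
have o0 : orient (p i0) (p m) z < 0.
  by have := zT _ _ (side_ordS m n2); rewrite mE orient_swap12 oppr_gt0.
pose P e := (e \in D) && (orient (p e.1) (p e.2) z < 0).
have P0 : P (i0, m) by rewrite /P D0.
case: (@arg_minnP _ (i0, m) P (fun e => e.2 - e.1)%N P0) => e /andP[eD oe] emin.
exists e => // u v uv; case: (side_faceP ncD dD eD uv) => [[-> ->]|[ltuv H]].
  by rewrite orient_swap12 oppr_gt0.
have nuv : u != v by have [] := sideP _ _ _ uv.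
have o_neq0 : orient (p u) (p v) z != 0.
  apply/eqP => /(on_chord nuv zT) /(side_drawing eD uv); exact: zN.
rewrite lt_neqAle eq_sym o_neq0 /=; case: H => [vu|].
  have <- : ordS u = v.
    by apply: val_inj; rewrite -[LHS]/(nat_of_ord (ordS u)) val_ordS -vu ltn_eqF.
  exact/ltW/zT/side_ordS.
move=> /setD1P[uve uvD]; rewrite leNgt; apply/negP => ouv.
have := emin (u, v); rewrite /P uvD ouv /= => /(_ isT).
have [uS vS _ _] := sideP _ _ _ uv.
have [/andP[h1 h2] /andP[h3 h4]] := (face_bounds uS, face_bounds vS).
move: uve h1 h2 h3 h4 ltuv; rewrite {1}(surjective_pairing e) xpair_eqE -!(inj_eq val_inj) /=.
by clear; lia.
Qed.

Lemma internal_facesE :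
  internal_faces p E = (fun e => cell p (face D e)) @` [set` D].
Proof.
apply/seteqP; split => F.
  move=> [Fb [z zN FE]]; rewrite {}FE in Fb *.
  have zT : cell p [set: 'I_n]%SET z.
    by apply: contrapT => zT; apply: (outer_unbounded zN zT).
  have [e eD ze] := point_location zN zT.
  by exists e => //; rewrite (cell_face_component eD ze).
move=> [e /= eD <-]; have S2 := face_card ncD dD eD.
split; first exact: bounded_cell.
have [z zS] := cell_nonempty hccw S2.
exists z; first exact: (cell_face_drawing eD).
by rewrite (cell_face_component eD zS).
Qed.

(** A cell thus determines its vertex set; distinct diagonals then have distinct faces, and [k] can
    be read off the boundary of a face. *)
Lemma cell_boundary_point (S : {set 'I_n}) i : (2 < #|S|)%N ->
  (closure (cell p S) `\` interior (cell p S)) (p i) <-> i \in S.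
Proof.
move=> S2; rewrite cell_boundary //; split => [[u [v [uv H]]]|iS].
  have [uS vS nuv _] := sideP _ _ _ uv.
  by case/orP: (point_on_segment hccw H nuv) => /eqP->.
exists i, (next (enum S) i); split; last exact: segment_left.
by apply: side_next => //; apply: ltnW.
Qed.

Lemma cell_inj (S S' : {set 'I_n}) : (2 < #|S|)%N -> (2 < #|S'|)%N ->
  cell p S = cell p S' -> S = S'.
Proof.
move=> S2 S2' Ecell; apply/setP => i; apply/idP/idP.
  by move=> /(cell_boundary_point i S2); rewrite Ecell => /(cell_boundary_point i S2').
by move=> /(cell_boundary_point i S2'); rewrite -Ecell => /(cell_boundary_point i S2).
Qed.

Lemma card_internal_faces : (internal_faces p E #= `I_#|D|)%card.
Proof.
rewrite internal_facesE.
pose f (i : 'I_#|D|) := cell p (face D (enum_val i)).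
have -> : (fun e => cell p (face D e)) @` [set` D] = f @` [set: 'I_#|D|].
  apply/seteqP; split => F.
    by move=> [e /= eD <-]; exists (enum_rank_in eD e) => //; rewrite /f enum_rankK_in.
  by move=> [i _ <-]; exists (enum_val i) => //; apply: enum_valP.
apply: (card_eq_trans _ (card_esym card_II)); apply: inj_card_eq => i j _ _.
have iD := enum_valP i; have jD := enum_valP j.
move=> /cell_inj E'; apply: enum_val_inj; apply: (face_inj ncD dD iD jD).
by apply: E'; apply: face_card.
Qed.

Lemma is_kgon_cell k e : e \in D ->
  is_kgon k p E (cell p (face D e)) <-> #|face D e| = k.
Proof.
move=> eD; have S2 := face_card ncD dD eD; set S := face D e in S2 *.
split => [[s [<- /andP[cs us] bs]]|kE].
  (* Both polygons have the same boundary, and no [p i] lies on a segment joining two other points,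
     so their vertices agree. *)
  have memS i : (i \in S) = (i \in s).
    apply/idP/idP => [/(cell_boundary_point i S2)|is_]; last first.
      apply/(cell_boundary_point i S2); rewrite bs; exists i => //; exact: segment_left.
    rewrite bs => -[x /= xs].
    have xne : x != next s x.
      have := next_cycle cs xs; rewrite /adj => /sE c2; apply/eqP => xn.
      by move: c2; rewrite -xn finset.setUid cards1.
    move=> /(point_on_segment hccw) /(_ xne) /orP[] /eqP-> //.
    by rewrite mem_next.
  by rewrite (eq_card memS); apply/card_uniqP.
exists (enum S); split; first by rewrite -cardE.
  rewrite /ucycle enum_uniq andbT; apply: cycle_from_next; first exact: enum_uniq.
  move=> x; rewrite mem_enum => xS; rewrite /adj; apply: (side_edge eD).
  by apply: side_next => //; apply: ltnW.
by rewrite cell_boundary // boundary_segments.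
Qed.

End Faces.

(** * Plane and 2-connected graphs *)

Section PlaneGraphs.
Variables (R : realType) (n : nat) (p : 'I_n -> R * R).
Hypothesis hccw : ccw_labelled p.
Variable E : {set {set 'I_n}}.
Hypothesis sE : simple_graph E.
Let D := diagonal_set E.
Implicit Types (u v w x y : 'I_n) (z : R * R).

(** The points [w] and [w'] lie on different open arcs between [u] and [m], so the segments meet
    although the edges share no vertex. *)
Lemma plane_cross u m w w' : plane p E -> [set u; m]%SET \in E -> [set w; w']%SET \in E ->
  cyc u w m -> cyc u m w' -> False.
Proof.
move=> pE e1 e2 c1 c2.
have c3 : cyc w w' u by move: c1 c2; rewrite /cyc; clear; lia.
have c4 : cyc w m w' by move: c1 c2; rewrite /cyc; clear; lia.
have [z z1 z2] := segments_cross (orient_cycN hccw c1) (orient_cyc hccw c2)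
  (orient_cyc hccw c3) (orient_cycN hccw c4).
have disj i : i \in [set u; m]%SET -> i \in [set w; w']%SET -> False.
  move=> /set2P[]-> /set2P[] /(congr1 (@nat_of_ord n)) ii;
    by move: c1 c2; rewrite /cyc ii; clear; lia.
have ne : [set u; m]%SET != [set w; w']%SET.
  by apply/eqP => ee; apply: (disj u); rewrite -?ee set21.
have [] := pE _ _ e1 e2 ne z; first by split; [exists u, m | exists w, w'].
by move=> i /= /setIP[h1 h2]; have := disj i h1 h2.
Qed.

Lemma plane_noncrossing : plane p E -> noncrossing D.
Proof.
move=> pE; apply/noncrossingP => e f; rewrite !inE => /andP[_ eE] /andP[_ fE] h1 h2 h3.
apply: (plane_cross pE eE fE); rewrite /cyc.
  by rewrite h1 h2.
by rewrite (ltn_trans h1 h2) h3.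
Qed.

Lemma orient_inside x y w : (x <= w <= y)%N -> orient (p x) (p y) (p w) <= 0.
Proof.
move=> /andP[]; case: ltngtP => // [xw _|/val_inj -> _]; last by rewrite orient_id1.
case: ltngtP => // [wy _|/val_inj -> _]; last by rewrite orient_id2.
by apply/ltW/(orient_cycN hccw); rewrite /cyc xw wy.
Qed.

Lemma orient_outside x y w : (x < y)%N -> (w <= x)%N || (y <= w)%N ->
  0 <= orient (p x) (p y) (p w).
Proof.
move=> xy; case: (ltngtP w x) => [wx _|_ /=|/val_inj -> _]; last by rewrite orient_id1.
  by apply/ltW/(orient_cyc hccw); rewrite /cyc wx xy !orbT.
case: ltngtP => // [yw _|/val_inj -> _]; last by rewrite orient_id2.
by apply/ltW/(orient_cyc hccw); rewrite /cyc yw xy.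
Qed.

Lemma orient_eq0 x y w : x != y -> orient (p x) (p y) (p w) = 0 -> w = x \/ w = y.
Proof.
move=> xy o0; case: (eqVneq w x) => [|wx]; first by left.
case: (eqVneq w y) => [|wy]; first by right.
have := cyc_total xy _ _; move=> /(_ w); rewrite ![_ == w]eq_sym => /(_ wy wx).
by case/orP => [/(orient_cyc hccw)|/(orient_cycN hccw)]; rewrite o0 ltxx.
Qed.

(** Both ends of [f] lie on the same closed side of the line through [e]. A common point is a convex
    combination of these ends on that line, so each end with nonzero weight is on the line and hence
    an end of [e]. Both weights cannot be nonzero, as then [e = f]. *)
Lemma noncrossing_plane : noncrossing D -> plane p E.
Proof.
move=> /noncrossingP nc e f eE fE ef z [].
have [x [y [xy eE' xyD]]] := edge_cases sE eE.
have [x' [y' [xy' fE' xyD']]] := edge_cases sE fE.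
have seg (g : {set 'I_n}) a b : g = [set a; b]%SET -> edge_segment p g z -> (a < b)%N ->
    segment (p a) (p b) z.
  move=> -> [c [d [E1 Hz]]] ab; case: (ltngtP c d) => [cd|dc|/val_inj cd].
  - by have [-> ->] := set2_inj ab cd E1.
  - by have [-> ->] := set2_inj ab dc (etrans E1 (finset.setUC _ _)); rewrite segment_sym.
  - move/setP: E1 => E1; have := E1 a; have := E1 b; rewrite !inE !eqxx cd orbT !orbb.
    by move=> /esym/eqP bd /esym/eqP ad; move: ab; rewrite bd ad ltnn.
move=> /(seg e x y eE')/(_ xy)/segmentP[s [_ _ zs]].
move=> /(seg f x' y' fE')/(_ xy')/segmentP[t [t0 t1 zt]].
have nxy : x != y by rewrite -(inj_eq val_inj) ltn_eqF.
have oz : orient (p x) (p y) z = 0.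
  by rewrite zs orient_segment orient_id1 orient_id2 !mulr0 addr0.
rewrite zt orient_segment in oz.
have cr1 : (x < x')%N -> (x' < y)%N -> (y < y')%N -> False.
  case: xyD => [|xyD]; first by clear; lia.
  case: xyD' => [|xyD']; first by clear; lia.
  exact: (nc _ _ xyD xyD').
have cr2 : (x' < x)%N -> (x < y')%N -> (y' < y)%N -> False.
  case: xyD => [|xyD]; first by clear; lia.
  case: xyD' => [|xyD']; first by clear; lia.
  exact: (nc _ _ xyD' xyD).
have same : orient (p x) (p y) (p x') <= 0 /\ orient (p x) (p y) (p y') <= 0 \/
            0 <= orient (p x) (p y) (p x') /\ 0 <= orient (p x) (p y) (p y').
  case: (boolP ((x <= x')%N && (y' <= y)%N)) => [/andP[h1 h2]|].
    by left; split; apply: orient_inside; move: h1 h2 xy'; clear; lia.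
  move=> h; right; split; apply: orient_outside => //; move: h cr1 cr2 xy xy'; clear; lia.
have : (1 - t) * orient (p x) (p y) (p x') = 0 /\ t * orient (p x) (p y) (p y') = 0.
  by case: same => -[]; nra.
move=> [/eqP + /eqP]; rewrite !mulf_eq0 => /orP[/eqP t1'|/eqP ox] /orP[/eqP t0'|/eqP oy].
- by move: t1'; rewrite t0' subr0 => /eqP; rewrite oner_eq0.
- have z' : z = p y' by rewrite zt -(subr0_eq t1') subrr scale0r scale1r add0r.
  rewrite z'; exists y' => //=; rewrite inE eE' fE' !inE eqxx orbT andbT.
  by case: (orient_eq0 nxy oy) => ->; rewrite eqxx ?orbT.
- have z' : z = p x' by rewrite zt t0' subr0 scale1r scale0r addr0.
  rewrite z'; exists x' => //=; rewrite inE eE' fE' !inE eqxx /= andbT.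
  by case: (orient_eq0 nxy ox) => ->; rewrite eqxx ?orbT.
- case/negP: ef; rewrite eE' fE'; apply/eqP.
  case: (orient_eq0 nxy ox) (orient_eq0 nxy oy) xy' => -> [] ->; rewrite ?ltnn //.
  by move=> yx; have := ltn_trans xy yx; rewrite ltnn.
Qed.

Lemma connect_closed (T : finType) (e : rel T) (C : pred T) (x y : T) :
  (forall a b, e a b -> C a -> C b) -> connect e x y -> C x -> C y.
Proof.
move=> eC /connectP[s]; elim: s x => [|a s IH] x /=; first by move=> _ ->.
by move=> /andP[xa sa] E' Cx; apply: IH sa E' (eC _ _ xa Cx).
Qed.

(** Suppose the hull side from [u] to [v] is missing, and let [m] be the first neighbour of [u]
    counter-clockwise. An edge from a vertex strictly between [u] and [m] cannot end at [u], by the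
    choice of [m], nor beyond [m] without crossing [{u, m}]. So deleting [m] separates [v] from
    [u]. *)
Lemma two_connected_hull : plane p E -> two_connected E -> has_hull E.
Proof.
move=> pE [n2 cE] u; set v := ordS u; have uv : side _ u v := side_ordS u n2.
have [_ _ nuv Huv] := sideP _ _ _ uv.
apply: contrapT => /negP uvE.
have nE w : [set u; w]%SET \in E -> w != u.
  by move=> /sE H; apply/eqP => wu; move: H; rewrite wu finset.setUid cards1.
have [m0 m0E] : exists m, [set u; m]%SET \in E.
  have := cE finset.set0 _ u v; rewrite cards0 !inE => /(_ isT isT isT) /connectP[[|a s] /=].
    by move=> _ vu; rewrite vu eqxx in nuv.
  by rewrite /adj => /andP[/andP[H _] _] _; exists a.
(* Up to the constant [u], the number of counter-clockwise steps from [u] to [w]. *)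
pose d (w : 'I_n) := if (u < w)%N then nat_of_ord w else (w + n)%N.
have [m mE mmin] := @arg_minnP _ m0 (fun m => [set u; m]%SET \in E) d m0E.
have mu := nE _ mE.
have mv : m != v by apply: contraNneq uvE => <-.
pose C := [pred w : 'I_n | cyc u w m].
have Cv : C v by apply: Huv; rewrite ?finset.in_setT.
have : connect [rel a b | [&& adj E a b, a \notin [set m]%SET & b \notin [set m]%SET]] v u.
  by apply: cE; rewrite ?cards1 // finset.in_set1 eq_sym.
move/(@connect_closed _ _ C) => H; have : C u; last by rewrite /C /= /cyc; clear; lia.
apply: H Cv => a b /=; rewrite /adj !finset.in_set1 => /and3P[abE am bm] Ca.
case: (eqVneq b u) => [bu|bu].
  have := mmin a; rewrite finset.setUC -bu abE => /(_ isT).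
  have := ltn_ord a; have := ltn_ord m; move: Ca; rewrite bu /d /cyc.
  by clear; case: (ltnP u a); case: (ltnP u m); lia.
case: (boolP (cyc u b m)) => // Cb; exfalso.
have bm' : cyc u m b.
  have mb : m != b by rewrite eq_sym.
  by move: Cb (cyc_total mb bu mu); rewrite /cyc; clear; lia.
exact: (plane_cross pE mE abE Ca bm').
Qed.

End PlaneGraphs.

(** The hull is a cycle, and deleting a vertex from it leaves a path through all the others. *)
Lemma hull_two_connected n (E : {set {set 'I_n}}) : (2 < n)%N -> has_hull E -> two_connected E.
Proof.
move=> n2 hE; split => // X X1 x y xX yX.
set e := [rel u v | _].
(* If [X] is empty, any vertex other than [x] and [y] may be deleted instead. *)
have [w [Xw xw yw]] : exists w, [/\ X \subset [set w]%SET, x != w & y != w].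
  case: (pickP (mem X)) => [w wX|X0].
    exists w; split.
    - apply/fintype.subsetP => v vX; rewrite finset.in_set1; apply/eqP.
      by have /card_le1_eqP := X1; apply.
    - by apply: contraNneq xX => ->.
    - by apply: contraNneq yX => ->.
  have : (0 < #|~: [set x; y]%SET|)%N.
    by rewrite cardsCs finset.setCK card_ord cards2; case: (x != y) => /=; move: n2; clear; lia.
  case/card_gt0P => w; rewrite !inE negb_or => /andP[wx wy].
  exists w; rewrite ![_ == w]eq_sym; split => //.
  by apply/fintype.subsetP => v; move: (X0 v) => /= ->.
have notX v : v != w -> v \notin X.
  by apply: contra => /(fintype.subsetP Xw); rewrite finset.in_set1.
have esym : connect_sym e.
  apply: sym_connect_sym => a b /=; rewrite /adj finset.setUC.
  by rewrite [(a \notin X) && _]andbC.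
pose g i := iter i (@ordS n) w.
have gE i : (i < n)%N -> g i = (if (w + i < n)%N then w + i else w + i - n)%N :> nat.
  elim: i => [|i IH] iltn; first by rewrite addn0 ltn_ord.
  have -> : g i.+1 = ordS (g i) by [].
  rewrite val_ordS IH; last exact: ltnW.
  by have := ltn_ord w; move: iltn; clear;
    case: (ltnP (w + i) n) => ?; case: eqP => ?; case: (ltnP (w + i.+1) n); lia.
have gw i : (0 < i < n)%N -> g i != w.
  move=> /andP[i0 iltn]; rewrite -(inj_eq val_inj) -[val (g i)]/(nat_of_ord (g i)) gE //=.
  by have := ltn_ord w; move: i0 iltn; clear; case: ifP; lia.
have con i : (0 < i < n)%N -> connect e (g 1%N) (g i).
  elim: i => // -[|i] IH /andP[_ iltn]; first exact: connect0.
  apply: connect_trans (IH _) _; first exact: ltnW.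
  apply: connect1; apply/and3P; split; first exact: (hE (g i.+1)).
    by apply/notX/gw; rewrite /= ltnW.
  exact/notX/gw.
have surj v : v != w -> connect e (g 1%N) v.
  move=> vw; pose i := (if (w < v) then v - w else v + n - w)%N.
  have vw' : v != w :> nat by rewrite (inj_eq val_inj).
  have i0 : (0 < i < n)%N.
    by have := ltn_ord w; have := ltn_ord v; move: vw'; rewrite /i; clear; case: ifP; lia.
  have -> : v = g i; last exact: con.
  apply: val_inj; rewrite -[RHS]/(nat_of_ord (g i)) gE; last by case/andP: i0.
  have := ltn_ord w; have := ltn_ord v; move: vw'; rewrite /i /=.
  by clear; case: (ltnP w v); case: ifP; lia.
by apply: connect_trans (surj _ yw); rewrite esym; apply: surj.
Qed.

(** Erasing a diagonal raises [h] by [k], and erasing the last vertex lowers both [b] and [h] by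
    one. For [h = 1] and [b = r * k + 1] this yields the number [r] of faces. *)
Lemma dissections_size n k b h (D : {set 'I_n * 'I_n}) : (b < n)%N ->
  D \in dissections n k b h -> b = (h + #|D| * k)%N.
Proof.
have [s] := ubnP (b + #|D|); elim: s b h D => // s IH b h D bs bn DW.
case: (posnP (indegree D b)) => [i0|ip]; last first.
  have [x [bb [bE xD DW' _ _]]] := dissections_remove DW ip.
  move: bs; rewrite (cardsD1 (x, bb)) xD add1n addnS => bs.
  have := IH b (h + k)%N _ bs bn DW'; rewrite mulSn addnA; exact.
case: b => [|b] in bs bn DW i0 *; last first.
  case: h => [|h] in DW *; first by rewrite dissections_pos0 ?inE in DW.
  have DW' : D \in dissections n k b h by rewrite -dissections_succ // DW i0.
  by rewrite addSn -(IH b h D) // ltnW.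
have D0 : D = finset.set0.
  apply/eqP; rewrite -[_ == _]negbK; apply/set0Pn => -[e eD].
  have [dD _ _ _] := dissectionsP _ _ _ _ DW.
  by have [] := diagonalsP _ _ dD e eD; case: (nat_of_ord e.2).
rewrite D0 cards0 addn0; case: (posnP h) => // h0.
by rewrite dissections_small // inE in DW.
Qed.

(** With [h = 1] only [0] and [b] are visible, so they follow each other in the chain; as [b > 1], a
    member of [D] joins them. *)
Lemma dissections_root n k b (D : {set 'I_n * 'I_n}) (u v : 'I_n) : (1 < b)%N ->
  u = 0%N :> nat -> v = b :> nat -> D \in dissections n k b 1 -> (u, v) \in D.
Proof.
move=> b1 u0 vb /dissectionsP[dD nD _ vD].
have uvis : u \in vis D 0 b.
  rewrite inE u0 /=; apply/coveredP => -[e _ [*]] //.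
have vvis : v \in vis D 0 b.
  rewrite inE vb leqnn /=; apply/coveredP => -[e eD [_ e2 _ e4]].
  by have := leq_trans e4 e2; rewrite ltnn.
have uv : (u < v)%N by rewrite u0 vb ltnW.
case: (vis_adjacent nD uvis vvis uv) => [w wvis uw wv|vu|//].
  have : [set u; w; v]%SET \subset vis D 0 b.
    by apply/fintype.subsetP => x; rewrite !finset.in_setU !finset.in_set1 => /orP[/orP[]|] /eqP->.
  move/subset_leq_card; rewrite vD finset.setUC cardsU1 cards2 !inE -!(inj_eq val_inj) /=.
  have -> : (v == w :> nat) = false by rewrite gtn_eqF.
  have -> : (v == u :> nat) = false by rewrite gtn_eqF.
  by have -> : (u == w :> nat) = false by rewrite ltn_eqF.
by move: b1; rewrite -vb vu u0.
Qed.

Section GraphOfDiagonals.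
Variable n : nat.
Hypothesis n2 : (2 < n)%N.
Implicit Types (D : {set 'I_n * 'I_n}) (E : {set {set 'I_n}}).

Definition graph_of D : {set {set 'I_n}} :=
  ([set [set i; ordS i] | i : 'I_n] :|: [set [set e.1; e.2] | e in D])%SET.

Lemma graph_of_hull D : has_hull (graph_of D).
Proof. by move=> i; apply/setUP; left; apply/imsetP; exists i. Qed.

Lemma graph_of_simple D : (forall e, e \in D -> e.1 != e.2) -> simple_graph (graph_of D).
Proof.
move=> dD e /setUP[/imsetP[i _ ->]|/imsetP[f /dD fD ->]]; rewrite cards2.
  by have [_ _ ->] := sideP _ _ _ (side_ordS i n2).
by rewrite fD.
Qed.

Lemma ordS_last (i : 'I_n) : i.+1 = n -> ordS i = 0%N :> nat.
Proof. by move=> iE; rewrite val_ordS iE eqxx. Qed.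

(** The hull edge [{n - 1, 0}] also passes the test in [diagonal_set], so [D] has to contain the
    outer side. *)
Lemma graph_ofK D : (forall e : 'I_n * 'I_n, e \in D -> (e.1.+1 < e.2)%N) ->
  (forall u v : 'I_n, u = 0%N :> nat -> v.+1 = n -> (u, v) \in D) ->
  diagonal_set (graph_of D) = D.
Proof.
move=> dD rD; apply/setP => -[x y]; rewrite diagonal_setE; apply/andP/idP => [[xy]|xyD]; last first.
  split; first exact: dD xyD.
  by apply/setUP; right; apply/imsetP; exists (x, y).
have xy' : (x < y)%N by apply: ltnW.
case/setUP => /imsetP[]; last first.
  move=> [a b] abD /= E; have ab : (a < b)%N by have /= := dD _ abD; apply: ltnW.
  by have [-> ->] := set2_inj xy' ab E.
move=> i _ E; have := val_ordS i; case: (i.+1 =P n) => [iE i0|_ i1].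
  have lt0 : (ordS i < i)%N by rewrite i0; move: n2 iE; clear; lia.
  by have [-> ->] := set2_inj xy' lt0 (etrans E (finset.setUC _ _)); apply: rD.
have lti : (i < ordS i)%N by rewrite i1.
by have [xi yi] := set2_inj xy' lti E; move: xy; rewrite xi yi i1 ltnn.
Qed.

Lemma diagonal_setK E : simple_graph E -> has_hull E -> graph_of (diagonal_set E) = E.
Proof.
move=> sE hE; apply/setP => e; apply/setUP/idP.
  case=> /imsetP[]; first by move=> i _ ->.
  by move=> f; rewrite inE => /andP[_ ?] ->.
move=> /(edge_cases sE)[x [y [xy -> [yx|xyD]]]]; last by right; apply/imsetP; exists (x, y).
left; apply/imsetP; exists x => //; congr [set _; _]%SET.
by apply: val_inj; rewrite -[RHS]/(nat_of_ord (ordS x)) val_ordS -yx ltn_eqF.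
Qed.

End GraphOfDiagonals.

(** Of the two hull edges at the root, [{0, n}] belongs to [diagonal_set] and [{n - 1, n}] does not,
    so the root has one edge more than its indegree. *)
Lemma root_degreeE n (E : {set {set 'I_n.+1}}) : (1 < n)%N -> simple_graph E ->
  has_hull E -> root_degree E = (indegree (diagonal_set E) n - 1)%N.
Proof.
move=> n1 sE hE; rewrite /root_degree /indegree.
have l1 : (n.-1 < n.+1)%N by lia.
pose q : 'I_n.+1 := Ordinal l1.
have qS : ordS q = ord_max.
  by apply: val_inj; rewrite -[LHS]/(nat_of_ord (ordS q)) val_ordS /= prednK ?(ltnW n1) // ltn_eqF.
pose A := [set e in diagonal_set E | e.2 == n :> nat]%SET.
have -> : [set e in E | ord_max \in e]%SET =
    [set q; ord_max]%SET |: [set [set e.1; e.2]%SET | e in A].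
  apply/setP => e; apply/setIdP/setU1P => [[eE me]|].
    have [x [y [xy ee xyD]]] := edge_cases sE eE.
    have yE : y = ord_max.
      move: me; rewrite ee => /set2P[xE|//].
      by have := ltn_ord y; rewrite ltnS leqNgt; move: xy; rewrite -xE /= => ->.
    case: xyD => [yx|xyD].
      left; rewrite ee yE; congr [set _; _]%SET; apply: val_inj.
      by move: yx; rewrite yE /=; clear; lia.
    right; apply/imsetP; exists (x, y); last by rewrite ee.
    by apply/setIdP; split => //=; rewrite yE.
  case=> [->|/imsetP[[x y] /setIdP[+ /eqP/= yn] ->]].
    by rewrite set22; split => //; rewrite -qS.
  rewrite diagonal_setE => /andP[_ xyE]; split => //.
  by rewrite (_ : y = ord_max) ?set22 //; apply: val_inj.
rewrite cardsU1 card_in_imset; last first.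
  move=> [x y] [x' y'] /setIdP[h1 _] /setIdP[h2 _] /= EE.
  have /= lt1 := diagonal_setP h1; have /= lt2 := diagonal_setP h2.
  by have [-> ->] := set2_inj (ltnW lt1) (ltnW lt2) EE.
suff -> : ([set q; ord_max]%SET \notin [set [set e.1; e.2]%SET | e in A]) = true.
  by rewrite add1n subSS.
apply/imsetP => -[[x y] /setIdP[/diagonal_setP /= xy _] EE].
have qm : (q < @ord_max n)%N by rewrite /= prednK // ltnW.
have [qx my] := set2_inj qm (ltnW xy) EE.
by move: xy; rewrite -qx -my /= prednK ?ltnn // ltnW.
Qed.

(** * The correspondence between k-angulations and dissections *)

Section Kangulations.
Variables (R : realType) (k n : nat) (p : 'I_n.+1 -> R * R).
Hypotheses (hccw : ccw_labelled p) (n1 : (1 < n)%N).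
Implicit Type E : {set {set 'I_n.+1}}.

Lemma kangulation_dissection E : kangulation k.+2 p E ->
  [/\ simple_graph E, has_hull E & diagonal_set E \in dissections n.+1 k n 1].
Proof.
move=> [sE pE cE fE]; have hE := two_connected_hull hccw sE pE cE.
have ncD := plane_noncrossing hccw pE.
have dD e : e \in diagonal_set E -> (e.1.+1 < e.2)%N := @diagonal_setP _ E e.
split=> //; apply/dissectionsP; split => //.
- by apply/diagonalsP => e /dD; split => //; rewrite -ltnS.
- move=> e eD; have [+ _] := is_kgon_cell hccw sE hE ncD k.+2 eD; apply; apply: fE.
  by rewrite internal_facesE //; exists e.
- have mE : ordS (@ord_max n) = ord0.
    by apply: val_inj; rewrite -[LHS]/(nat_of_ord (ordS ord_max)) ordS_last.
  have D0 : (ord0, ord_max) \in diagonal_set E.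
    by rewrite diagonal_setE; apply/andP; split => //; rewrite finset.setUC -mE.
  have -> : vis (diagonal_set E) 0 n = [set ord0; ord_max]%SET.
    apply/setP => v; apply/idP/set2P => [|].
      rewrite inE => /and3P[_ _ vc].
      case: (eqVneq v ord0) => [|v0]; first by left.
      case: (eqVneq v ord_max) => [|vm]; first by right.
      case/negP: vc; apply/coveredP; exists (ord0, ord_max) => //; split => //=.
        by rewrite lt0n.
      by rewrite ltn_neqAle -ltnS ltn_ord andbT.
    case=> ->; rewrite inE /= ?leqnn; apply/coveredP => -[e eD [_ e2 _]] //=.
    by rewrite ltnNge e2.
  by rewrite cards2 -(inj_eq val_inj) ltn_eqF //= ltnW.
Qed.

Lemma dissection_kangulation D : D \in dissections n.+1 k n 1 ->
  kangulation k.+2 p (graph_of D) /\ diagonal_set (graph_of D) = D.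
Proof.
move=> DW; have [dD ncD fD _] := dissectionsP _ _ _ _ DW.
have dD' (e : 'I_n.+1 * 'I_n.+1) : e \in D -> (e.1.+1 < e.2)%N.
  by move=> /(diagonalsP _ _ dD)[].
have DK : diagonal_set (graph_of D) = D.
  apply: graph_ofK => // u v u0 [vn]; exact: dissections_root DW.
have hE := graph_of_hull D.
have sE : simple_graph (graph_of D).
  by apply: graph_of_simple => // e /dD' eD; rewrite -(inj_eq val_inj) ltn_eqF // ltnW.
split=> //; split => //.
- by apply: noncrossing_plane => //; rewrite DK.
- exact: hull_two_connected.
- rewrite internal_facesE ?DK // => F [e /= eD <-].
  have := @is_kgon_cell _ _ p hccw _ sE hE _ k.+2 e; rewrite DK => /(_ ncD eD) [_].
  by apply; apply: fD.
Qed.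

End Kangulations.

Theorem theorem6 (R : realType) (k r : nat) (hk : (3 <= k)%N) (hr : (1 <= r)%N)
    (p : 'I_((k - 2) * r).+2 -> R * R)
    (hconv : convex_position p) (hccw : ccw_labelled p)
    (j : nat) (hj : (1 <= j <= r)%N) :
  (kangulation_count k r j p)%:R =
    j%:R / r%:R * 'C((k - 1) * r - j - 1, r - j)%:R :> rat.
Proof.
(* From here on [k] stands for the [k - 2] of the statement. *)
case: k => [|[|k]] // in hk p hconv hccw *.
have k0 : (0 < k)%N by [].
have E2 : (k.+2 - 2 = k)%N by lia.
rewrite [(k.+2 - 1)%N]subn1 /=.
set n := ((k.+2 - 2) * r).+1.
have nE : n = (r * k).+1 by rewrite /n E2 mulnC.
have n1 : (1 < n)%N by rewrite nE ltnS muln_gt0 hr.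
have -> : kangulation_count k.+2 r j p =
    #|[set D in dissections n.+1 k n 1 | indegree D n == j]%SET|.
  rewrite /kangulation_count.
  have <- : (@diagonal_set n.+1) @: [set E | `[< [/\ kangulation k.+2 p E,
      (internal_faces p E #= `I_r)%card & root_degree E = (j - 1)%N] >]]%SET =
      [set D in dissections n.+1 k n 1 | indegree D n == j]%SET.
    apply/setP => D; apply/imsetP/setIdP => [[E]|[DW /eqP Dj]].
      rewrite inE => /asboolP[kE _ rE] ->.
      have [sE hE DW] := kangulation_dissection hccw n1 kE.
      split => //; apply/eqP; move: rE; rewrite root_degreeE //.
      (* The outer side ends at the root, so the indegree is positive and [j - 1] determines [j]
         despite the truncated subtraction. *)
      have : (0 < indegree (diagonal_set E) n)%N.
        apply/card_gt0P; exists (ord0, ord_max); apply/setIdP; split => //.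
        exact: dissections_root DW.
      case/andP: hj; clear => h1 _ h2 h3; rewrite -(subnK h2) h3 subnK //.
    have [kE DK] := dissection_kangulation hccw n1 DW.
    have [sE _ _ _] := kE; have hE := graph_of_hull D.
    have ncD : noncrossing D by case/dissectionsP: DW.
    exists (graph_of D) => //; rewrite inE; apply/asboolP; split => //.
      have := card_internal_faces hccw n1 sE hE; rewrite DK => /(_ ncD).
      suff -> : #|D| = r by [].
      have := etrans (esym nE) (dissections_size (ltnSn n) DW); rewrite add1n => -[].
      by move/esym/eqP; rewrite eqn_pmul2r // => /eqP.
    by rewrite root_degreeE // DK Dj.
  rewrite card_in_imset; first by apply: eq_card => E; rewrite inE.
  move=> E1 E3; rewrite !finset.in_set; move=> /asboolP[k1 _ _] /asboolP[k3 _ _] DE.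
  have [s1 h1 _] := kangulation_dissection hccw n1 k1.
  have [s3 h3 _] := kangulation_dissection hccw n1 k3.
  by rewrite -[E1](diagonal_setK s1 h1) DE diagonal_setK.
rewrite nE card_dissections_last // add0n.
have rn : (r * k < (r * k).+2)%N by rewrite ltnW.
have := card_dissections_root k0 hj rn.
move/(congr1 (fun x => x%:R : rat)); rewrite !natrM => H.
have r0 : r%:R != 0 :> rat by rewrite pnatr_eq0 -lt0n.
by apply: (mulfI r0); rewrite H mulrA mulrCA mulfV // mulr1.
Qed.
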